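(* Let $E(n)$ be any one of the following five expressions. (i) $E(n)=(n^2-3n+2)M_1(n)-8M_2(n)$. (ii) $E(n)=(3n^3-13n^2+18n-8)M_1(n)+(12n^2-120n+212)M_2(n)-960M_3(n)$. (iii) $E(n)=(25n^4-171n^3+423n^2-447n+170)M_1(n)+(300n^3-3554n^2+12900n-14990)M_2(n)+(2400n^2-60480n+214080)M_3(n)-725760M_4(n)$. (iv) $E(n)=(126n^5-1303n^4+5073n^3-9323n^2+8097n-2670)M_1(n)+(3024n^4-48900n^3+288014n^2-737100n+695490)M_2(n)+(60480n^3-1510080n^2+10644480n-23496480)M_3(n)+(725760n^2-36288000n+218453760)M_4(n)-580608000M_5(n)$. (v) $E(n)=(300n^8-1542n^7-33049n^6+377959n^5-1651959n^4+3726801n^3-4575760n^2+2903750n-746500)M_1(n)$ $+(12000n^7-91008n^6-2799900n^5+50637162n^4-351366300n^3+1239098170n^2-2210467000n+1585493500)M_2(n)$ $+(432000n^6-3548160n^5-236343840n^4+5133219840n^3-42370071840n^2+161101416000n-236150560800)M_3(n)$ $+(12096000n^5-72817920n^4-17599680000n^3+396192142080n^2-3123876672000n+8555162112000)M_4(n)$ $+(193536000n^4-1056513024000n^2+21310248960000n-112944125952000)M_5(n)$ $+(-46495088640000n+604436152320000)M_6(n)-1115882127360000M_7(n)$. Then for all positive integers $n$ we have $E(n)\geq 0$, and for $n\geq 2$ we have $E(n)=0$ if and only if $n$ is prime.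
   Context: For an integer $a\geq 1$ and a positive integer $n$, MacMahon's partition function $M_a(n)$ is $$M_a(n):=\sum_{\substack{0<s_1<s_2<\cdots<s_a\\ n=m_1s_1+m_2s_2+\cdots+m_as_a}} m_1m_2\cdots m_a,$$ where the sum runs over all tuples of positive integers $s_1<s_2<\cdots<s_a$ and $m_1,\dots,m_a$ with $n=m_1s_1+\cdots+m_as_a$. Equivalently, $$\sum_{n\ge 1}M_a(n)q^n=\sum_{0<s_1<\cdots<s_a}\frac{q^{s_1+\cdots+s_a}}{(1-q^{s_1})^2\cdots(1-q^{s_a})^2}.$$ *)

(* Defs.v *)
From mathcomp Require Import all_boot all_order all_algebra.
Set Implicit Arguments.
Unset Strict Implicit.
Unset Printing Implicit Defensive.

Import GRing.Theory Num.Theory.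
Local Open Scope ring_scope.

(* Bounding the s i and m i by n loses no terms: positive s i, m i with
   \sum_i m i * s i = n satisfy s i <= n and m i <= n. *)
Definition macmahon (a n : nat) : nat :=
  (\sum_(s : {ffun 'I_a -> 'I_n.+1} |
         [forall i, 0 < s i]
         && [forall i : 'I_a, forall j : 'I_a, (i < j) ==> (s i < s j)])
   \sum_(m : {ffun 'I_a -> 'I_n.+1} |
         [forall i, 0 < m i] && (\sum_(i < a) m i * s i == n))
     \prod_(i < a) m i)%N.

(* Coefficients are written c%:R because nat literals, unlike ring_scope ones,
   are not expanded to unary when large. *)
Definition E1 (n : nat) : int :=
  let x := n%:Z in
  let M (a : nat) := (macmahon a n)%:Z in
    (x ^+ 2 - 3%:R * x + 2%:R) * M 1
  - 8%:R * M 2.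

Definition E2 (n : nat) : int :=
  let x := n%:Z in
  let M (a : nat) := (macmahon a n)%:Z in
    (3%:R * x ^+ 3 - 13%:R * x ^+ 2 + 18%:R * x - 8%:R) * M 1
  + (12%:R * x ^+ 2 - 120%:R * x + 212%:R) * M 2
  - 960%:R * M 3.

Definition E3 (n : nat) : int :=
  let x := n%:Z in
  let M (a : nat) := (macmahon a n)%:Z in
    (25%:R * x ^+ 4 - 171%:R * x ^+ 3 + 423%:R * x ^+ 2
     - 447%:R * x + 170%:R) * M 1
  + (300%:R * x ^+ 3 - 3554%:R * x ^+ 2 + 12900%:R * x - 14990%:R) * M 2
  + (2400%:R * x ^+ 2 - 60480%:R * x + 214080%:R) * M 3
  - 725760%:R * M 4.

Definition E4 (n : nat) : int :=
  let x := n%:Z in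
  let M (a : nat) := (macmahon a n)%:Z in
    (126%:R * x ^+ 5 - 1303%:R * x ^+ 4 + 5073%:R * x ^+ 3
     - 9323%:R * x ^+ 2 + 8097%:R * x - 2670%:R) * M 1
  + (3024%:R * x ^+ 4 - 48900%:R * x ^+ 3 + 288014%:R * x ^+ 2
     - 737100%:R * x + 695490%:R) * M 2
  + (60480%:R * x ^+ 3 - 1510080%:R * x ^+ 2 + 10644480%:R * x
     - 23496480%:R) * M 3
  + (725760%:R * x ^+ 2 - 36288000%:R * x + 218453760%:R) * M 4
  - 580608000%:R * M 5.

Definition E5 (n : nat) : int :=
  let x := n%:Z in
  let M (a : nat) := (macmahon a n)%:Z in
    (300%:R * x ^+ 8 - 1542%:R * x ^+ 7 - 33049%:R * x ^+ 6
     + 377959%:R * x ^+ 5 - 1651959%:R * x ^+ 4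
     + 3726801%:R * x ^+ 3 - 4575760%:R * x ^+ 2 + 2903750%:R * x
     - 746500%:R) * M 1
  + (12000%:R * x ^+ 7 - 91008%:R * x ^+ 6 - 2799900%:R * x ^+ 5
     + 50637162%:R * x ^+ 4 - 351366300%:R * x ^+ 3
     + 1239098170%:R * x ^+ 2 - 2210467000%:R * x + 1585493500%:R) * M 2
  + (432000%:R * x ^+ 6 - 3548160%:R * x ^+ 5
     - 236343840%:R * x ^+ 4 + 5133219840%:R * x ^+ 3
     - 42370071840%:R * x ^+ 2 + 161101416000%:R * x
     - 236150560800%:R) * M 3
  + (12096000%:R * x ^+ 5 - 72817920%:R * x ^+ 4
     - 17599680000%:R * x ^+ 3 + 396192142080%:R * x ^+ 2
     - 3123876672000%:R * x + 8555162112000%:R) * M 4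
  + (193536000%:R * x ^+ 4 - 1056513024000%:R * x ^+ 2
     + 21310248960000%:R * x - 112944125952000%:R) * M 5
  + (- 46495088640000%:R * x + 604436152320000%:R) * M 6
  - 1115882127360000%:R * M 7.

(* Main.v *)
Require Import Defs.
From Stdlib Require Import BinInt QArith_base Qreduction Setoid Morphisms.
From mathcomp Require Import all_boot all_order all_algebra.
From mathcomp Require Import ssrZ zify ring lra.
Set Implicit Arguments.
Unset Strict Implicit.
Unset Printing Implicit Defensive.

Import Order.TTheory GRing.Theory Num.Theory.
Local Open Scope ring_scope.

(** Every one of the five expressions is a positive multiple of a divisor sum
    whose vanishing can be read off.  Up to a constant (for [E1], up to the
    factor [n]), [E n] is the sum over the divisors [d] of [n] of

      w * (d^2 - 1) * (n^2 - d^2)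

    with a positive weight [w]: [n/d] for [E1], and [d], [d^3], [d^5],
    [d^7 (1 + n^2 + d^2)] for [E2] to [E5].  All terms are nonnegative and only
    those of [d = 1] and [d = n] vanish, so that for [n >= 2] the sum is zero
    exactly when [n] has no other divisor ([divisor_sum_detects_primes]).

    To find this sum, consider the series [S k], the generating function of
    the sum of the [k]-th powers of the divisors of [n], and the derivation
    [Der = q d/dq], which multiplies the coefficient of [q^n] by [n].  For odd
    [k] these are Eisenstein series up to normalization, and everything takes
    place in the ring of quasimodular forms, which is generated by [S 1], [S 3]
    and [S 5].  Three facts are needed.

    - MacMahon's series [A_a] is the [a]-th elementary symmetric function of
      the series [x_s = q^s / (1 - q^s)^2] ([macmahonE]).  The [j]-th power sum
      of the [x_s] is a linear combination of [S 1], ..., [S (2j-1)]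
      ([power_sum_mpart], [bin_oddE]), so Newton's identities express [A_a]
      as a polynomial in these.

    - [S 7], [S 9], [S 11], [S 13] and [Der (S 1)], [Der (S 3)], [Der (S 5)] are
      polynomials in [S 1], [S 3], [S 5].  All seven relations are instances of
      one elementary identity ([euclid_identity]), which comes from

        L_a L_b = L_(a+b) (1 + L_a + L_b),   L_a = q^a / (1 - q^a),

      by summing over [a] and [b] with a weight that is invariant under the
      symmetries of the hexagonal lattice; on the solutions of
      [a x + b y = n] this is one step of Euclid's algorithm.

    - Hence both sides of each claimed identity are polynomials in [S 1],
      [S 3], [S 5] with rational coefficients, and it suffices to compute them
      and compare ([table_identity]).

    Series are represented by polynomials, and identities between them hold
    for the coefficients below some order [N]; to reach the coefficient of
    [q^n], take [N = n + 1]. *)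

(** * Power series up to a given order *)

Definition eq_upto (N : nat) (f g : {poly rat}) : Prop :=
  forall i : nat, (i < N)%N -> f`_i = g`_i.

Notation "f = g %[upto N ]" := (eq_upto N f g)
  (at level 70, g at next level, format "f  =  g  %[upto  N ]") : ring_scope.

#[export] Instance eq_upto_equivalence N : Equivalence (eq_upto N).
Proof.
split; first by [].
- by move=> f g fg i /fg.
- by move=> f g h fg gh i lti; rewrite fg ?gh.
Qed.

Lemma eq_upto_refl N f g : f = g -> f = g %[upto N].
Proof. by move->. Qed.

#[export] Instance eq_upto_add N :
  Proper (eq_upto N ==> eq_upto N ==> eq_upto N) +%R.
Proof. by move=> f f' ff g g' gg i lti; rewrite !coefD ff ?gg. Qed.

#[export] Instance eq_upto_opp N : Proper (eq_upto N ==> eq_upto N) -%R.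
Proof. by move=> f f' ff i lti; rewrite !coefN ff. Qed.

#[export] Instance eq_upto_mul N :
  Proper (eq_upto N ==> eq_upto N ==> eq_upto N) *%R.
Proof.
move=> f f' ff g g' gg i lti; rewrite !coefM; apply: eq_bigr => j _.
by rewrite ff ?gg // (leq_ltn_trans _ lti) ?leq_subr // -ltnS.
Qed.

#[export] Instance eq_upto_scale N c : Proper (eq_upto N ==> eq_upto N) ( *:%R c).
Proof. by move=> f f' ff i lti; rewrite !coefZ ff. Qed.

Lemma eq_upto_sum N (I : Type) (r : seq I) (P : pred I) (F G : I -> {poly rat}) :
    (forall i, P i -> F i = G i %[upto N]) ->
  \sum_(i <- r | P i) F i = \sum_(i <- r | P i) G i %[upto N].
Proof.
by move=> FG; elim/big_rec2: _ => // i f g Pi fg; apply: eq_upto_add; first exact: FG.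
Qed.

Lemma eq_upto_sum_nat N m n (F G : nat -> {poly rat}) :
    (forall i, (m <= i < n)%N -> F i = G i %[upto N]) ->
  \sum_(m <= i < n) F i = \sum_(m <= i < n) G i %[upto N].
Proof.
by move=> FG; rewrite big_nat [X in _ = X %[upto N]]big_nat; apply: eq_upto_sum.
Qed.

Definition Der (f : {poly rat}) : {poly rat} := 'X * f^`().

Lemma coefDer f i : (Der f)`_i = i%:R * f`_i.
Proof. by case: i => [|i]; rewrite coefXM ?mul0r // coef_deriv mulr_natl. Qed.

#[export] Instance eq_upto_Der N : Proper (eq_upto N ==> eq_upto N) Der.
Proof. by move=> f f' ff i lti; rewrite !coefDer ff. Qed.

Lemma DerM f g : Der (f * g) = Der f * g + f * Der g.
Proof. by rewrite /Der derivM; ring. Qed.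

Lemma DerD f g : Der (f + g) = Der f + Der g.
Proof. by rewrite /Der derivD; ring. Qed.

Lemma DerB f g : Der (f - g) = Der f - Der g.
Proof. by rewrite /Der derivB; ring. Qed.

Lemma DerZ c f : Der (c *: f) = c *: Der f.
Proof. by rewrite /Der derivZ -scalerAr. Qed.

Lemma Der_sum (I : Type) (r : seq I) (P : pred I) (F : I -> {poly rat}) :
  Der (\sum_(i <- r | P i) F i) = \sum_(i <- r | P i) Der (F i).
Proof. by rewrite /Der raddf_sum mulr_sumr. Qed.

Lemma DerXn k : Der 'X^k = k%:R *: 'X^k.
Proof.
by apply/polyP => i; rewrite coefDer coefZ coefXn; case: eqP => [->|_]; rewrite ?mulr0.
Qed.

(** * Lambert series *)

Section LambertSeries.

Variable N : nat.

(** The series [X^a / (1 - X^a)], truncated. *)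
Definition geom (a : nat) : {poly rat} := \sum_(1 <= x < N) 'X^(a * x).

(** For [0 < n < N], the coefficient of [X^n] is the sum of [c d] over the divisors
    [d] of [n]. *)
Definition lambert (c : nat -> rat) : {poly rat} :=
  \sum_(1 <= a < N) c a *: geom a.

Lemma eq_lambert c d :
  (forall a, (0 < a)%N -> c a = d a) -> lambert c = lambert d.
Proof. by move=> cd; apply: eq_big_nat => a /andP[a_gt0 _]; rewrite cd. Qed.

Lemma lambertD c d : lambert (fun a => c a + d a) = lambert c + lambert d.
Proof. by rewrite -big_split; apply: eq_bigr => a _; rewrite scalerDl. Qed.

Lemma lambertZ k c : lambert (fun a => k * c a) = k *: lambert c.
Proof. by rewrite scaler_sumr; apply: eq_bigr => a _; rewrite scalerA. Qed.

Lemma Xn_upto0 m : (N <= m)%N -> 'X^m = 0 %[upto N].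
Proof.
move=> leNm i ltiN; rewrite coefXn coef0.
by rewrite ltn_eqF // (leq_trans ltiN).
Qed.

Lemma geom_upto0 a : (N <= a)%N -> geom a = 0 %[upto N].
Proof.
move=> leNa; transitivity (\sum_(1 <= x < N) (0 : {poly rat})); last by rewrite big1.
apply: eq_upto_sum_nat => x /andP[x_gt0 _]; apply: Xn_upto0.
by rewrite (leq_trans leNa) // leq_pmulr.
Qed.

Lemma geomE a : (0 < a)%N -> (1 - 'X^a) * geom a = 'X^a %[upto N].
Proof.
move=> a_gt0; case: (posnP N) => [-> //|N_gt0].
have -> : (1 - 'X^a) * geom a = 'X^a - 'X^(a * N).
  have /= := telescope_sumr (fun x => 'X^(a * x) : {poly rat}) N_gt0.
  rewrite muln1 => tele; rewrite mulr_sumr -[RHS]opprB -tele -sumrN.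
  by apply: eq_bigr => x _; rewrite mulnS exprD; ring.
by rewrite (Xn_upto0 (leq_pmull _ _)) // subr0.
Qed.

Lemma geom_unit a : (0 < a)%N -> (1 - 'X^a) * (1 + geom a) = 1 %[upto N].
Proof. by move=> a_gt0; rewrite mulrDr (geomE a_gt0) mulr1 subrK. Qed.

(** [1 - X^a] is invertible modulo [X^N], so denominators can be cleared. *)
Lemma subX_upto_inj a f g : (0 < a)%N ->
  (1 - 'X^a) * f = (1 - 'X^a) * g %[upto N] -> f = g %[upto N].
Proof.
move=> a_gt0 fg.
rewrite -[f]mul1r -[g]mul1r -(geom_unit a_gt0) ![(1 - _) * (1 + _)]mulrC.
by rewrite -!mulrA fg.
Qed.

(** For [u = X^a] and [v = X^b], the left-hand side is the sum of [u^x v^y] over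
    positive [x] and [y]; the three terms on the right collect [x = y], [x > y]
    and [x < y]. *)
Lemma geomM a b : (0 < a)%N -> (0 < b)%N ->
  geom a * geom b = geom (a + b) * (1 + geom a + geom b) %[upto N].
Proof.
move=> a_gt0 b_gt0; have ab_gt0 : (0 < a + b)%N by rewrite addn_gt0 a_gt0.
apply: (subX_upto_inj a_gt0); apply: (subX_upto_inj b_gt0).
apply: (subX_upto_inj ab_gt0).
set u : {poly rat} := 'X^a; set v : {poly rat} := 'X^b; set w : {poly rat} := 'X^(a + b).
have Ew : w = u * v by rewrite /w exprD.
transitivity ((1 - w) * ((1 - u) * geom a) * ((1 - v) * geom b)).
  by apply: eq_upto_refl; ring.
rewrite !geomE // -/u -/v.
transitivity ((1 - w) * geom (a + b) *
   ((1 - u) * (1 - v) + (1 - u) * geom a * (1 - v) + (1 - v) * geom b * (1 - u))).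
  rewrite !geomE // -/u -/v -/w Ew.
  by apply: eq_upto_refl; ring.
by apply: eq_upto_refl; ring.
Qed.

(** Both sides are [a] times the sum of [x X^(a x)]; this turns the diagonal terms
    of a double Lambert series into a derivative. *)
Lemma Der_geom a : (0 < a)%N -> Der (geom a) = a%:R *: (geom a ^+ 2 + geom a) %[upto N].
Proof.
move=> a_gt0.
apply: (subX_upto_inj a_gt0); set u : {poly rat} := 'X^a.
have Du : Der u = a%:R *: u by apply: DerXn.
have /eq_upto_Der := geomE a_gt0; rewrite -/u DerM DerB Du => eqD.
have D1 : Der 1 = 0 by rewrite /Der derivC mulr0.
transitivity (a%:R *: u * (1 + geom a)); last first.
  transitivity ((1 - u) * geom a * (a%:R *: (1 + geom a))).
    by rewrite geomE // -/u -!mul_polyC; apply: eq_upto_refl; ring.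
  by rewrite -!mul_polyC; apply: eq_upto_refl; ring.
transitivity ((Der 1 - a%:R *: u) * geom a + (1 - u) * Der (geom a)
    + a%:R *: u * geom a); first by rewrite D1; apply: eq_upto_refl; ring.
by rewrite eqD mulrDr mulr1.
Qed.

End LambertSeries.

(** * The convolution identity *)

Lemma sum_symmetric_nat (V : nmodType) (F : nat -> nat -> V) n :
    (forall a b, F a b = F b a) ->
  \sum_(1 <= a < n) \sum_(1 <= b < n) F a b =
  (\sum_(1 <= b < n) \sum_(1 <= a < b) F a b) *+ 2 + \sum_(1 <= a < n) F a a.
Proof.
move=> Fsym; elim: n => [|[|n] IHn]; try by rewrite !big_geq ?mul0rn ?addr0.
have R (G : nat -> V) :
  \sum_(1 <= i < n.+2) G i = \sum_(1 <= i < n.+1) G i + G n.+1.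
  by rewrite big_nat_recr.
under eq_bigr => a _ do rewrite R.
rewrite big_split /= !R IHn mulrnDl.
under [\sum_(1 <= b < n.+1) F n.+1 b]eq_bigr => b _ do rewrite Fsym.
rewrite mulr2n -!addrA; do 2!congr (_ + _).
by rewrite addrCA; congr (_ + _); apply: addrCA.
Qed.

Section EuclidIdentity.

Variable N : nat.
Local Notation L := (geom N).

(** Terms with [a + b >= N] are negligible, so a sum over [a] and [b] may be
    rearranged according to [c = a + b]. *)
Lemma sum_addn_upto (K : nat -> nat -> nat -> {poly rat}) :
    (forall a b c, (N <= c)%N -> K a b c = 0 %[upto N]) ->
  \sum_(1 <= a < N) \sum_(1 <= b < N) K a b (a + b)%N =
  \sum_(1 <= c < N) \sum_(1 <= a < c) K a (c - a)%N c %[upto N].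
Proof.
move=> K0.
have -> : \sum_(1 <= c < N) \sum_(1 <= a < c) K a (c - a)%N c =
          \sum_(1 <= a < N) \sum_(a.+1 <= c < N) K a (c - a)%N c.
  transitivity (\sum_(1 <= c < N) \sum_(1 <= a < N | (a < c)%N) K a (c - a)%N c).
    apply: eq_big_nat => c /andP[_ ltcN].
    by rewrite (big_nat_widen _ _ _ _ _ (ltnW ltcN)).
  rewrite (exchange_big_dep_nat xpredT) //=; apply: eq_big_nat => a _.
  by rewrite [RHS](big_nat_widenl _ 1).
apply: eq_upto_sum_nat => a /andP[a_gt0 ltaN].
rewrite (@big_cat_nat _ _ _ (N - a)) ?subn_gt0 ?leq_subr //=.
have -> : \sum_(N - a <= b < N) K a b (a + b)%N = 0 %[upto N].
  transitivity (\sum_(N - a <= b < N) (0 : {poly rat})); last by rewrite big1.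
  by apply: eq_upto_sum_nat => b /andP[leb _]; apply: K0; rewrite -leq_subLR.
rewrite addr0 -[a.+1]add1n big_addn; apply: eq_upto_sum_nat => b _.
by rewrite addnK addnC.
Qed.

(** The two arguments of [g] are, up to sign, the second and the square of the
    third elementary symmetric function of [x], [y] and [- x - y]; so [h] is
    invariant under permutations and sign change of this triple, whence
    [h x (y - x) = k x y].  Expanding [L a * L b] by [geomM] gives a term in
    [L (a + b)], which is a simple Lambert series, and two terms that become,
    with [c = a + b], the sum of [k a c] times [L a * L c] over [a < c].  By the
    symmetry of [k] they amount to the full sum over [a] and [c] without its
    diagonal, and the diagonal is computed by [Der_geom]. *)
Lemma euclid_identity (g : rat -> rat -> rat) :
  let h x y := g (x ^+ 2 + x * y + y ^+ 2) ((x * y * (x + y)) ^+ 2) in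
  let k x y := h x (- y) in
  \sum_(1 <= a < N) \sum_(1 <= b < N) (h a%:R b%:R - k a%:R b%:R) *: (L a * L b)
    = lambert N (fun c => \sum_(1 <= a < c) k a%:R c%:R + g (c%:R ^+ 2) 0)
      - Der (lambert N (fun c => g (c%:R ^+ 2) 0 / c%:R)) %[upto N].
Proof.
move=> h k.
have hC x y : h x y = h y x by congr g; ring.
have kC x y : k x y = k y x by congr g; ring.
have kxx x : k x x = g (x ^+ 2) 0 by congr g; ring.
have hk x y : h x (y - x) = k x y by congr g; ring.
have E1 : \sum_(1 <= a < N) \sum_(1 <= b < N) h a%:R b%:R *: L (a + b)
    = lambert N (fun c => \sum_(1 <= a < c) k a%:R c%:R) %[upto N].
  rewrite (sum_addn_upto (K := fun a b c => h a%:R b%:R *: L c)); last first.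
    by move=> a b c leNc; rewrite geom_upto0 // scaler0.
  apply: eq_upto_refl; apply: eq_big_nat => c _; rewrite scaler_suml.
  by apply: eq_big_nat => a /andP[_ ltac]; rewrite natrB ?hk // ltnW.
have E2 : \sum_(1 <= a < N) \sum_(1 <= b < N) h a%:R b%:R *: (L (a + b) * L a)
    = \sum_(1 <= c < N) \sum_(1 <= a < c) k a%:R c%:R *: (L a * L c) %[upto N].
  rewrite (sum_addn_upto (K := fun a b c => h a%:R b%:R *: (L c * L a))); last first.
    by move=> a b c leNc; rewrite geom_upto0 // mul0r scaler0.
  apply: eq_upto_refl; apply: eq_big_nat => c _; apply: eq_big_nat => a /andP[_ ltac].
  by rewrite natrB ?hk 1?mulrC // ltnW.
have E3 : \sum_(1 <= a < N) \sum_(1 <= b < N) h a%:R b%:R *: (L (a + b) * L b)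
    = \sum_(1 <= a < N) \sum_(1 <= b < N) h a%:R b%:R *: (L (a + b) * L a).
  rewrite exchange_big /=; apply: eq_bigr => a _; apply: eq_bigr => b _.
  by rewrite hC addnC.
have E4 : \sum_(1 <= a < N) \sum_(1 <= b < N) h a%:R b%:R *: (L a * L b)
   = lambert N (fun c => \sum_(1 <= a < c) k a%:R c%:R)
     + (\sum_(1 <= c < N) \sum_(1 <= a < c) k a%:R c%:R *: (L a * L c)) *+ 2 %[upto N].
  rewrite mulr2n -E2 -{2}E3 -E1 -!big_split /=.
  apply: eq_upto_sum_nat => a /andP[a_gt0 _]; rewrite -!big_split /=.
  apply: eq_upto_sum_nat => b /andP[b_gt0 _].
  by rewrite geomM // -!scalerDr; apply: eq_upto_refl; congr (_ *: _); ring.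
have E5 : Der (lambert N (fun c => g (c%:R ^+ 2) 0 / c%:R))
    = \sum_(1 <= c < N) k c%:R c%:R *: (L c * L c)
      + lambert N (fun c => g (c%:R ^+ 2) 0) %[upto N].
  rewrite Der_sum -big_split /=; apply: eq_upto_sum_nat => c /andP[c_gt0 _].
  rewrite DerZ Der_geom // scalerA divfK ?pnatr_eq0 -?lt0n // kxx -expr2.
  by rewrite scalerDr.
rewrite E5 lambertD.
have -> : \sum_(1 <= a < N) \sum_(1 <= b < N) (h a%:R b%:R - k a%:R b%:R) *: (L a * L b)
    = \sum_(1 <= a < N) \sum_(1 <= b < N) h a%:R b%:R *: (L a * L b)
      - \sum_(1 <= a < N) \sum_(1 <= b < N) k a%:R b%:R *: (L a * L b).
  rewrite -sumrB; apply: eq_bigr => a _; rewrite -sumrB.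
  by apply: eq_bigr => b _; rewrite scalerBl.
rewrite E4 (@sum_symmetric_nat _ (fun a b => k a%:R b%:R *: (L a * L b))).
  by apply: eq_upto_refl; ring.
by move=> a b; rewrite kC mulrC.
Qed.

End EuclidIdentity.

(** * Relations between the divisor series *)

(** The inner sums [\sum_(1 <= a < c) k a c] of [euclid_identity] are sums of
    polynomials in [t = a (c - a)], because [a^2 - a c + c^2 = c^2 - t].  Powers
    up to the fourth are enough for the weights used here. *)
Lemma sum_mul_compl_poly (q0 q1 q2 q3 q4 : rat) (c : nat) : (0 < c)%N ->
  let z : rat := c%:R in
  let t (a : nat) : rat := a%:R * (z - a%:R) in
  \sum_(1 <= a < c) (q0 + q1 * t a + q2 * t a ^+ 2 + q3 * t a ^+ 3 + q4 * t a ^+ 4) =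
    q0 * (z - 1) + q1 * ((z ^+ 3 - z) / 6) + q2 * ((z ^+ 5 - z) / 30)
  + q3 * (z ^+ 7 / 140 + z ^+ 3 / 60 - z / 42)
  + q4 * (z ^+ 9 / 630 + 2 / 63 * z ^+ 3 - z / 30).
Proof.
move=> c_gt0 z t.
(* [B k] is the polynomial whose value at a natural number [n] is the sum of
   the [k]-th powers of the naturals less than [n]. *)
pose B1 x : rat := x ^+ 2 / 2 - x / 2.
pose B2 x : rat := x ^+ 3 / 3 - x ^+ 2 / 2 + x / 6.
pose B3 x : rat := x ^+ 4 / 4 - x ^+ 3 / 2 + x ^+ 2 / 4.
pose B4 x : rat := x ^+ 5 / 5 - x ^+ 4 / 2 + x ^+ 3 / 3 - x / 30.
pose B5 x : rat := x ^+ 6 / 6 - x ^+ 5 / 2 + 5 / 12 * x ^+ 4 - x ^+ 2 / 12.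
pose B6 x : rat := x ^+ 7 / 7 - x ^+ 6 / 2 + x ^+ 5 / 2 - x ^+ 3 / 6 + x / 42.
pose B7 x : rat :=
  x ^+ 8 / 8 - x ^+ 7 / 2 + 7 / 12 * x ^+ 6 - 7 / 24 * x ^+ 4 + x ^+ 2 / 12.
pose B8 x : rat :=
  x ^+ 9 / 9 - x ^+ 8 / 2 + 2 / 3 * x ^+ 7 - 7 / 15 * x ^+ 5 + 2 / 9 * x ^+ 3 - x / 30.
pose G (a : nat) : rat := let x := a%:R in
  q0 * x + q1 * (z * B1 x - B2 x) + q2 * (z ^+ 2 * B2 x - 2 * z * B3 x + B4 x)
  + q3 * (z ^+ 3 * B3 x - 3 * z ^+ 2 * B4 x + 3 * z * B5 x - B6 x)
  + q4 * (z ^+ 4 * B4 x - 4 * z ^+ 3 * B5 x + 6 * z ^+ 2 * B6 x - 4 * z * B7 x + B8 x).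
transitivity (\sum_(1 <= a < c) (G a.+1 - G a)).
  apply: eq_bigr => a _; rewrite /t /G -[a.+1]addn1 natrD /=.
  by rewrite /B1 /B2 /B3 /B4 /B5 /B6 /B7 /B8; field.
by rewrite (telescope_sumr G c_gt0) /G /= -/z /B1 /B2 /B3 /B4 /B5 /B6 /B7 /B8; field.
Qed.

Definition divisor_series (N k : nat) : {poly rat} := lambert N (fun a => a%:R ^+ k).

Lemma coef_lincomb (T : Type) (l : seq T) (c : T -> rat) (f : T -> {poly rat}) i :
  (\sum_(m <- l) c m *: f m)`_i = \sum_(m <- l) c m * (f m)`_i.
Proof. by rewrite coef_sum; apply: eq_bigr => m _; rewrite coefZ. Qed.

Lemma Der0 : Der 0 = 0.
Proof. by rewrite /Der deriv0 mulr0. Qed.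

Section DivisorSeriesRelations.

Variable N : nat.
Local Notation S := (divisor_series N).

(** [lambert2] turns a monomial [a^i b^j] into the product [S i * S j]. *)
Definition lambert2 (F : nat -> nat -> rat) : {poly rat} :=
  \sum_(1 <= a < N) \sum_(1 <= b < N) F a b *: (geom N a * geom N b).

Lemma eq_lambert2 F G : (forall a b, F a b = G a b) -> lambert2 F = lambert2 G.
Proof. by move=> FG; apply: eq_bigr => a _; apply: eq_bigr => b _; rewrite FG. Qed.

Lemma lambert2_monomial i j :
  lambert2 (fun a b => a%:R ^+ i * b%:R ^+ j) = S i * S j.
Proof.
rewrite /S /lambert mulr_suml; apply: eq_bigr => a _; rewrite mulr_sumr.
by apply: eq_bigr => b _; rewrite -scalerAl -scalerAr scalerA.
Qed.

Lemma lambert_poly (r : seq (rat * nat)) :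
  lambert N (fun c => \sum_(m <- r) m.1 * c%:R ^+ m.2) = \sum_(m <- r) m.1 *: S m.2.
Proof.
under [RHS]eq_bigr => m _ do rewrite scaler_sumr.
rewrite exchange_big; apply: eq_bigr => a _; rewrite scaler_suml.
by apply: eq_bigr => m _; rewrite scalerA.
Qed.

Lemma lambert2_poly (F : seq (rat * (nat * nat))) :
  lambert2 (fun a b => \sum_(m <- F) m.1 * (a%:R ^+ m.2.1 * b%:R ^+ m.2.2
                                             + a%:R ^+ m.2.2 * b%:R ^+ m.2.1)) =
  \sum_(m <- F) (m.1 * 2) *: (S m.2.1 * S m.2.2).
Proof.
transitivity (\sum_(m <- F) m.1 *: (lambert2 (fun a b => a%:R ^+ m.2.1 * b%:R ^+ m.2.2)
                          + lambert2 (fun a b => a%:R ^+ m.2.2 * b%:R ^+ m.2.1))).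
  rewrite /lambert2.
  under [RHS]eq_bigr => m _ do rewrite -big_split scaler_sumr /=.
  rewrite [RHS]exchange_big; apply: eq_bigr => a _ /=.
  under [RHS]eq_bigr => m _ do rewrite -big_split scaler_sumr /=.
  rewrite [RHS]exchange_big; apply: eq_bigr => b _; rewrite scaler_suml.
  by apply: eq_bigr => m _; rewrite -scalerDl scalerA.
apply: eq_bigr => m _; rewrite !lambert2_monomial [S m.2.2 * _]mulrC.
by rewrite -mulr2n -scaler_nat scalerA.
Qed.

(** [euclid_identity] for a polynomial weight [g].  The hypotheses are polynomial
    identities: [q0], ..., [q4] expand [g] in powers of [t = a (c - a)], [F] lists
    the coefficients of the difference of the weights at [y] and [- y], each
    monomial together with its mirror image, [r] those of the simple Lambert
    series, and [s] the exponents in its differentiated part.  The conclusion is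
    about coefficients because the instances below are then linear arithmetic. *)
Lemma convolution_identity (g : rat -> rat -> rat) (q0 q1 q2 q3 q4 : rat -> rat)
    (F : seq (rat * (nat * nat))) (r : seq (rat * nat)) (s : seq nat) :
    (forall z t, g (z ^+ 2 - t) ((z * t) ^+ 2) =
       q0 z + q1 z * t + q2 z * t ^+ 2 + q3 z * t ^+ 3 + q4 z * t ^+ 4) ->
    (forall x y, g (x ^+ 2 + x * y + y ^+ 2) ((x * y * (x + y)) ^+ 2)
       - g (x ^+ 2 - x * y + y ^+ 2) ((x * y * (x - y)) ^+ 2)
       = \sum_(m <- F) m.1 * (x ^+ m.2.1 * y ^+ m.2.2 + x ^+ m.2.2 * y ^+ m.2.1)) ->
    (forall z, q0 z * (z - 1) + q1 z * ((z ^+ 3 - z) / 6) + q2 z * ((z ^+ 5 - z) / 30)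
       + q3 z * (z ^+ 7 / 140 + z ^+ 3 / 60 - z / 42)
       + q4 z * (z ^+ 9 / 630 + 2 / 63 * z ^+ 3 - z / 30) + g (z ^+ 2) 0
       = \sum_(m <- r) m.1 * z ^+ m.2) ->
    (forall z, g (z ^+ 2) 0 = z * \sum_(k <- s) z ^+ k) ->
  forall i, (i < N)%N ->
  \sum_(m <- F) m.1 * 2 * (S m.2.1 * S m.2.2)`_i =
    \sum_(m <- r) m.1 * (S m.2)`_i - \sum_(k <- s) (Der (S k))`_i.
Proof.
move=> gE FE rE sE.
suff H : \sum_(m <- F) (m.1 * 2) *: (S m.2.1 * S m.2.2) =
    \sum_(m <- r) m.1 *: S m.2 - Der (\sum_(k <- s) S k) %[upto N].
  by move=> i lti; have := H i lti; rewrite coefB Der_sum !coef_lincomb coef_sum.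
have -> : \sum_(k <- s) S k = lambert N (fun c => \sum_(k <- s) c%:R ^+ k).
  by rewrite exchange_big; apply: eq_bigr => c _; rewrite scaler_suml.
rewrite -lambert2_poly -lambert_poly.
have /= eucl := @euclid_identity N g.
transitivity (lambert2 (fun a b : nat => let x : rat := a%:R in let y : rat := b%:R in
  g (x ^+ 2 + x * y + y ^+ 2) ((x * y * (x + y)) ^+ 2)
  - g (x ^+ 2 + x * - y + (- y) ^+ 2) ((x * - y * (x - y)) ^+ 2))).
  apply: eq_upto_refl; apply: eq_lambert2 => a b /=; rewrite -FE.
  by congr (_ - g _ _); ring.
rewrite {1}/lambert2 eucl; apply: eq_upto_refl.
congr (_ - Der _); apply: eq_lambert => c c_gt0; last first.
  by rewrite sE mulrC mulKf // pnatr_eq0 -lt0n.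
rewrite -rE -(sum_mul_compl_poly _ _ _ _ _ c_gt0); congr (_ + _).
by apply: eq_bigr => a _; rewrite -gE; congr g; ring.
Qed.

(** In the relations below, [e] stands for [x^2 + x y + y^2] and [f] for the square
    of [x y (x + y)].  Powers of [e] alone give derivatives; as soon as [f]
    divides the weight, it vanishes for [t = 0] and no derivative occurs.  The
    first three relations, the third together with [divisor_series7], amount to
    Ramanujan's differential equations. *)
Lemma Der_divisor_series1 i : (i < N)%N ->
  (Der (S 1))`_i = (5 / 6) * (S 3)`_i + (1 / 6) * (S 1)`_i - 2 * (S 1 * S 1)`_i.
Proof.
unshelve epose proof (@convolution_identity (fun e _ => e)
  (fun z => z ^+ 2) (fun _ => -1) (fun _ => 0) (fun _ => 0) (fun _ => 0)
  [:: (1, (1, 1)%N)]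
  [:: (5 / 6, 3%N); (1 / 6, 1%N)] [:: 1%N] _ _ _ _) as H;
  [by move=> *; rewrite ?big_cons ?big_nil /=; field .. |].
move=> lti; move: (H i lti); rewrite !(big_seq1, big_cons, big_nil) /=; lra.
Qed.

Lemma Der_divisor_series3 i : (i < N)%N ->
  (Der (S 3))`_i = (7 / 10) * (S 5)`_i + (1 / 3) * (S 3)`_i - (1 / 30) * (S 1)`_i
    - 8 * (S 1 * S 3)`_i.
Proof.
unshelve epose proof (@convolution_identity (fun e _ => e ^+ 2)
  (fun z => z ^+ 4) (fun z => - 2 * z ^+ 2) (fun _ => 1) (fun _ => 0) (fun _ => 0)
  [:: (4, (1, 3)%N)]
  [:: (7 / 10, 5%N); (1 / 3, 3%N); (- (1 / 30), 1%N)] [:: 3%N] _ _ _ _) as H;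
  [by move=> *; rewrite ?big_cons ?big_nil /=; field .. |].
move=> lti; move: (H i lti); rewrite !(big_seq1, big_cons, big_nil) /=; lra.
Qed.

Lemma Der_divisor_series5 i : (i < N)%N ->
  (Der (S 5))`_i = (83 / 140) * (S 7)`_i + (1 / 2) * (S 5)`_i - (7 / 60) * (S 3)`_i
    + (1 / 42) * (S 1)`_i - 12 * (S 1 * S 5)`_i - 14 * (S 3 * S 3)`_i.
Proof.
unshelve epose proof (@convolution_identity (fun e _ => e ^+ 3)
  (fun z => z ^+ 6) (fun z => - 3 * z ^+ 4) (fun z => 3 * z ^+ 2) (fun _ => -1) (fun _ => 0)
  [:: (6, (1, 5)%N); (7, (3, 3)%N)]
  [:: (83 / 140, 7%N); (1 / 2, 5%N); (- (7 / 60), 3%N); (1 / 42, 1%N)] [:: 5%N] _ _ _ _) as H;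
  [by move=> *; rewrite ?big_cons ?big_nil /=; field .. |].
move=> lti; move: (H i lti); rewrite !(big_seq1, big_cons, big_nil) /=; lra.
Qed.

(** This is the classical identity between the Eisenstein series [E_8] and the
    square of [E_4]; the next relations do the same for weights 10, 12 and 14. *)
Lemma divisor_series7 i : (i < N)%N ->
  (S 7)`_i = (S 3)`_i + 120 * (S 3 * S 3)`_i.
Proof.
unshelve epose proof (@convolution_identity (fun _ f => f)
  (fun _ => 0) (fun _ => 0) (fun z => z ^+ 2) (fun _ => 0) (fun _ => 0)
  [:: (2, (3, 3)%N)]
  [:: (1 / 30, 7%N); (- (1 / 30), 3%N)] [::] _ _ _ _) as H;
  [by move=> *; rewrite ?big_cons ?big_nil /=; field .. |].
move=> lti; move: (H i lti); rewrite !(big_seq1, big_cons, big_nil) /=; lra.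
Qed.

Lemma divisor_series9 i : (i < N)%N ->
  (S 9)`_i = (21 / 11) * (S 5)`_i - (10 / 11) * (S 3)`_i + (5040 / 11) * (S 3 * S 5)`_i.
Proof.
unshelve epose proof (@convolution_identity (fun e f => e * f)
  (fun _ => 0) (fun _ => 0) (fun z => z ^+ 4) (fun z => - z ^+ 2) (fun _ => 0)
  [:: (6, (3, 5)%N)]
  [:: (11 / 420, 9%N); (- (1 / 20), 5%N); (1 / 42, 3%N)] [::] _ _ _ _) as H;
  [by move=> *; rewrite ?big_cons ?big_nil /=; field .. |].
move=> lti; move: (H i lti); rewrite !(big_seq1, big_cons, big_nil) /=; lra.
Qed.

Lemma divisor_series11 i : (i < N)%N ->
  (S 11)`_i = (42 / 13) * (S 7)`_i - (50 / 13) * (S 5)`_i + (21 / 13) * (S 3)`_i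
    + (10080 / 13) * (S 3 * S 7)`_i + (12600 / 13) * (S 5 * S 5)`_i.
Proof.
unshelve epose proof (@convolution_identity (fun e f => e ^+ 2 * f)
  (fun _ => 0) (fun _ => 0) (fun z => z ^+ 6) (fun z => - 2 * z ^+ 4) (fun z => z ^+ 2)
  [:: (8, (3, 7)%N); (10, (5, 5)%N)]
  [:: (13 / 630, 11%N); (- (1 / 15), 7%N); (5 / 63, 5%N); (- (1 / 30), 3%N)] [::] _ _ _ _) as H;
  [by move=> *; rewrite ?big_cons ?big_nil /=; field .. |].
move=> lti; move: (H i lti); rewrite !(big_seq1, big_cons, big_nil) /=; lra.
Qed.

Lemma divisor_series13 i : (i < N)%N ->
  (S 13)`_i = - 20 * (S 7)`_i + 21 * (S 5)`_i + 10080 * (S 5 * S 7)`_i.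
Proof.
unshelve epose proof (@convolution_identity (fun _ f => f ^+ 2)
  (fun _ => 0) (fun _ => 0) (fun _ => 0) (fun _ => 0) (fun z => z ^+ 4)
  [:: (8, (5, 7)%N)]
  [:: (1 / 630, 13%N); (2 / 63, 7%N); (- (1 / 30), 5%N)] [::] _ _ _ _) as H;
  [by move=> *; rewrite ?big_cons ?big_nil /=; field .. |].
move=> lti; move: (H i lti); rewrite !(big_seq1, big_cons, big_nil) /=; lra.
Qed.

End DivisorSeriesRelations.

(** * MacMahon's functions as elementary symmetric functions *)

Definition esym (R : comNzRingType) (I : Type) (y : I -> R) (r : seq I) (k : nat) : R :=
  (\prod_(i <- r) (1 + y i *: 'X))`_k.

Section NewtonIdentities.

Variables (R : comNzRingType) (I : Type) (y : I -> R).

Lemma esym0 r : esym y r 0 = 1.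
Proof.
rewrite /esym; elim: r => [|i r IHr]; rewrite ?big_nil ?coefC // big_cons.
by rewrite coef0M IHr coefD coefZ coefX coefC mulr0 addr0 mulr1.
Qed.

Lemma esym_nil k : esym y [::] k.+1 = 0.
Proof. by rewrite /esym big_nil coefC. Qed.

Lemma esym_consS i r k : esym y (i :: r) k.+1 = esym y r k.+1 + y i * esym y r k.
Proof. by rewrite /esym big_cons mulrDl mul1r coefD -scalerAl coefZ coefXM. Qed.

(** For [u = y i] and [F] the generating polynomial of [r], this compares the
    coefficients of [X^k] in [u / (1 + u X) * ((1 + u X) F) = u F]. *)
Lemma esym_cons_alternating i r k :
  \sum_(j < k.+1) (-1) ^+ j * y i ^+ j.+1 * esym y (i :: r) (k - j) = y i * esym y r k.
Proof.
elim: k => [|k IHk].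
  by rewrite big_ord_recl big_ord0 !esym0 expr0 expr1 mul1r addr0.
rewrite big_ord_recl /= subn0 expr0 expr1 mul1r esym_consS.
rewrite (eq_bigr (fun j : 'I_k.+1 =>
  - y i * ((-1) ^+ j * y i ^+ j.+1 * esym y (i :: r) (k - j)))); last first.
  by move=> j _; rewrite /bump /= add1n subSS [in LHS]exprS [in X in X * _]exprS; ring.
by rewrite -mulr_sumr IHk; ring.
Qed.

Lemma newton_identity r k :
  k.+1%:R * esym y r k.+1 =
  \sum_(j < k.+1) (-1) ^+ j * (\sum_(i <- r) y i ^+ j.+1) * esym y r (k - j).
Proof.
elim: r k => [|i r IHr] k.
  by rewrite esym_nil mulr0 big1 // => j _; rewrite big_nil mulr0 mul0r.
under eq_bigr => j _ do rewrite big_cons mulrDr mulrDl.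
rewrite big_split /= esym_cons_alternating esym_consS.
suff -> : \sum_(j < k.+1) (-1) ^+ j * (\sum_(i <- r) y i ^+ j.+1) * esym y (i :: r) (k - j)
    = k.+1%:R * esym y r k.+1 + k%:R * (y i * esym y r k).
  by rewrite -[k.+1]addn1 natrD; ring.
case: k => [|k].
  by rewrite IHr !big_ord_recl !big_ord0 !esym0 mul0r !addr0.
rewrite big_ord_recr /= subnn esym0.
rewrite (eq_bigr (fun j : 'I_k.+1 =>
    (-1) ^+ j * (\sum_(i <- r) y i ^+ j.+1) * esym y r (k.+1 - j) +
    y i * ((-1) ^+ j * (\sum_(i <- r) y i ^+ j.+1) * esym y r (k - j)))); last first.
  by move=> [j ltj] _ /=; rewrite subSn // esym_consS; ring.
rewrite big_split /= -mulr_sumr -IHr (IHr k.+1) [in RHS]big_ord_recr /= subnn esym0; ring.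
Qed.

End NewtonIdentities.

Lemma esym_sets (R : comNzRingType) (I : finType) (y : I -> R) k :
  esym y (index_enum I) k = \sum_(A : {set I} | #|A| == k) \prod_(i in A) y i.
Proof.
rewrite /esym; under eq_bigr do rewrite addrC.
rewrite bigA_distr coef_sum [RHS]big_mkcond; apply: eq_bigr => A _.
rewrite -big_mkcond /= scaler_prod prodr_const coefZ coefXn eq_sym.
by case: eqP; rewrite ?mulr1 ?mulr0.
Qed.

Section IncreasingFunctions.

Variables (a n : nat).
Implicit Types (s : {ffun 'I_a -> 'I_n.+1}) (A : {set 'I_n.+1}).

Let ltord : rel 'I_n.+1 := relpre val ltn.

Let ltord_trans : transitive ltord.
Proof. by move=> x y z; apply: ltn_trans. Qed.

Lemma sorted_enum_set A : sorted ltord (enum A).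
Proof.
rewrite /enum_mem sorted_filter // -enumT.
by rewrite /ltord -sorted_map val_enum_ord iota_ltn_sorted.
Qed.

Definition increasing s := [forall i : 'I_a, forall j : 'I_a, (i < j)%N ==> (s i < s j)%N].

Lemma increasing_inj s : increasing s -> injective s.
Proof.
move=> /forallP incs i j eqs; apply/val_inj.
case: (ltngtP i j) => // ltij.
- by have := implyP (forallP (incs i) j) ltij; rewrite eqs ltnn.
- by have := implyP (forallP (incs j) i) ltij; rewrite eqs ltnn.
Qed.

Definition enum_fun A : {ffun 'I_a -> 'I_n.+1} := [ffun i : 'I_a => nth ord0 (enum A) i].

Lemma enum_funK A : #|A| = a -> [set enum_fun A i | i : 'I_a] = A.
Proof.
move=> cardA; have sizeA : size (enum A) = a by rewrite -cardE.
apply/setP => x; apply/imsetP/idP => [[i _ ->]|Ax].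
  by rewrite ffunE -mem_enum mem_nth // sizeA.
have ltxa : (index x (enum A) < a)%N by rewrite -sizeA index_mem mem_enum.
by exists (Ordinal ltxa); rewrite // ffunE nth_index ?mem_enum.
Qed.

Lemma increasing_enum_fun A : #|A| = a -> increasing (enum_fun A).
Proof.
move=> cardA; apply/forallP => i; apply/forallP => j; apply/implyP => ltij.
rewrite !ffunE; apply: (sorted_ltn_nth ltord_trans ord0 (sorted_enum_set A)) => //.
all: by rewrite inE -cardE cardA.
Qed.

Lemma enum_fun_image s : increasing s -> enum_fun [set s i | i : 'I_a] = s.
Proof.
move=> incs.
have -> : enum_fun [set s i | i : 'I_a] = [ffun i : 'I_a => nth ord0 (map s (enum 'I_a)) i].
  apply/ffunP => i; rewrite !ffunE; congr (nth _ _ _).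
  apply: (irr_sorted_eq ltord_trans) => [x||| x]; first exact: ltnn.
  - exact: sorted_enum_set.
  - rewrite sorted_map; apply: (@sub_sorted _ (relpre val ltn)) => [j k /= ltjk|].
      by move/forallP: incs => /(_ j) /forallP /(_ k) /implyP /(_ ltjk).
    by rewrite -sorted_map val_enum_ord iota_ltn_sorted.
  - rewrite mem_enum; apply/imsetP/mapP => [] [j _ ->]; exists j => //.
    by rewrite mem_enum.
by apply/ffunP => i; rewrite ffunE (nth_map i) ?size_enum_ord // nth_ord_enum.
Qed.

(** Increasing functions correspond to subsets of the same size, by image and by
    enumeration. *)
Lemma sum_increasing (R : comNzRingType) (y : 'I_n.+1 -> R) :
  \sum_(s : {ffun 'I_a -> 'I_n.+1} | increasing s) \prod_(i < a) y (s i) =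
  \sum_(A : {set 'I_n.+1} | #|A| == a) \prod_(i in A) y i.
Proof.
rewrite [RHS](reindex_onto (fun s => [set s i | i : 'I_a]) enum_fun) /=; last first.
  by move=> A /eqP /enum_funK.
apply: eq_big => s; last first.
  move=> /increasing_inj injs; rewrite big_imset /=; first exact: eq_bigl.
  by move=> i j _ _ /injs.
apply/idP/andP => [incs|[/eqP cards /eqP <-]]; last exact: increasing_enum_fun.
by rewrite enum_fun_image // card_imset ?card_ord //; apply: increasing_inj.
Qed.

End IncreasingFunctions.

(** The power [(X / (1 - X)^2)^(j+1)], truncated ([bin_series_exp]). *)
Definition bin_series (N j : nat) : {poly rat} := \poly_(m < N) 'C(m + j, j.*2.+1)%:R.

Lemma sum_bin_diag j n : (\sum_(b < n.+1) 'C(b + j, j.*2.+1) = 'C(n + j.+1, j.*2.+2))%N.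
Proof.
elim: n => [|n IHn].
  by rewrite big_ord_recr big_ord0 /= !add0n !bin_small //; lia.
by rewrite big_ord_recr /= IHn [in RHS]addSn binS addSnnS.
Qed.

(** The first difference in [n] of either side is given by [sum_bin_diag]. *)
Lemma sum_mul_bin j n :
  (\sum_(b < n.+1) (n - b) * 'C(b + j, j.*2.+1) = 'C(n + j.+1, j.*2.+3))%N.
Proof.
elim: n => [|n IHn].
  by rewrite big_ord_recr big_ord0 /= mul0n bin_small //; lia.
rewrite big_ord_recr /= subnn mul0n addn0.
rewrite (eq_bigr (fun b : 'I_n.+1 => (n - b) * 'C(b + j, j.*2.+1) + 'C(b + j, j.*2.+1))%N).
  by rewrite big_split /= IHn sum_bin_diag [in RHS]addSn binS.
by move=> [b ltb] _ /=; rewrite subSn // mulSn addnC.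
Qed.

Lemma bin_series_exp N j : bin_series N 0 ^+ j.+1 = bin_series N j %[upto N].
Proof.
elim: j => [|j IHj]; first by rewrite expr1.
rewrite exprS IHj => n ltnN; rewrite coefMr coef_poly ltnN doubleS -sum_mul_bin natr_sum.
apply: eq_bigr => [[b ltb] _] /=.
rewrite !coef_poly (leq_ltn_trans (leq_subr _ _) ltnN) (leq_ltn_trans _ ltnN) //.
by rewrite addn0 bin1 natrM.
Qed.

Section MacMahonSeries.

Variable N : nat.

(** The series [X^s / (1 - X^s)^2]: the choices of one part [s] with multiplicity
    [m], counted with weight [m]. *)
Definition mpart (s : nat) : {poly rat} := \sum_(m < N) m%:R *: 'X^(m * s).

(** The index set starts at 0, which is not a part; there the series is made to
    vanish. *)
Definition mpart_pos (i : 'I_N) : {poly rat} := if (0 < i)%N then mpart i else 0.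

Definition macmahon_series (a : nat) : {poly rat} := esym mpart_pos (index_enum 'I_N) a.

Lemma mpart_exp s j : (0 < s)%N ->
  mpart s ^+ j.+1 = \sum_(m < N) 'C(m + j, j.*2.+1)%:R *: 'X^(m * s) %[upto N].
Proof.
move=> s_gt0.
have compE k : bin_series N k \Po 'X^s = \sum_(m < N) 'C(m + k, k.*2.+1)%:R *: 'X^(m * s).
  rewrite /bin_series poly_def raddf_sum; apply: eq_bigr => m _ /=.
  by rewrite comp_polyZ comp_Xn_poly -exprM mulnC.
have -> : mpart s = bin_series N 0 \Po 'X^s.
  by rewrite compE; apply: eq_bigr => m _; rewrite addn0 bin1.
rewrite -compE -rmorphXn /= => i ltiN; rewrite !coef_comp_poly_Xn //.
by case: ifP => // _; rewrite bin_series_exp // (leq_ltn_trans (leq_div _ _)).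
Qed.

Lemma power_sum_mpart j :
  \sum_i mpart_pos i ^+ j.+1 = lambert N (fun m => 'C(m + j, j.*2.+1)%:R) %[upto N].
Proof.
transitivity (\sum_(i < N | (0 < i)%N)
    \sum_(m < N | (0 < m)%N) 'C(m + j, j.*2.+1)%:R *: ('X^(m * i) : {poly rat})).
  rewrite [X in _ = X %[upto N]]big_mkcond /=.
  apply: eq_upto_sum => i _; rewrite /mpart_pos.
  case: ifP => [i_gt0|_]; last by rewrite expr0n.
  rewrite mpart_exp //; apply: eq_upto_refl; rewrite [RHS]big_mkcond; apply: eq_bigr => m _.
  by case: posnP => // ->; rewrite add0n bin_small ?scale0r //; lia.
apply: eq_upto_refl; rewrite exchange_big /=.
have sumE (F : nat -> {poly rat}) : \sum_(1 <= i < N) F i = \sum_(i < N | (0 < i)%N) F i.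
  by rewrite (big_nat_widenl _ 0) // big_mkord.
rewrite /lambert sumE; apply: eq_bigr => m _.
by rewrite /geom sumE scaler_sumr.
Qed.

End MacMahonSeries.

Lemma coef_prod_mpart a n (s : {ffun 'I_a -> 'I_n.+1}) :
  (\prod_(i < a) mpart n.+1 (s i))`_n =
  \sum_(m : {ffun 'I_a -> 'I_n.+1} |
         [forall i, (0 < m i)%N] && (\sum_(i < a) m i * s i == n)%N) \prod_(i < a) (m i)%:R.
Proof.
rewrite bigA_distr_bigA coef_sum [RHS]big_mkcond; apply: eq_bigr => m _.
rewrite scaler_prod coefZ prodrXr coefXn eq_sym.
case: forallP => [_|/forallP] /=; first by case: eqP; rewrite ?mulr1 ?mulr0.
rewrite negb_forall => /existsP[i]; rewrite -eqn0Ngt => /eqP mi0.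
by rewrite (bigD1 i) //= mi0 !mul0r.
Qed.

Lemma macmahonE a n : (macmahon a n)%:R = (macmahon_series n.+1 a)`_n.
Proof.
rewrite /macmahon_series esym_sets -sum_increasing coef_sum natr_sum.
rewrite [LHS]big_mkcond [RHS]big_mkcond; apply: eq_bigr => s _.
rewrite -/(increasing s); case: ifP => [/andP[/forallP s_gt0 ->]|].
  rewrite (eq_bigr (fun i => mpart n.+1 (s i))); last first.
    by move=> i _; rewrite /mpart_pos s_gt0.
  by rewrite coef_prod_mpart natr_sum; apply: eq_bigr => m _; rewrite natr_prod.
case: ifP => // incs; rewrite andbT => /negbT; rewrite negb_forall => /existsP[i].
rewrite -eqn0Ngt => /eqP si0.
by rewrite (bigD1 i) //= /mpart_pos si0 mul0r coef0.
Qed.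

(** * Polynomials in three variables with rational coefficients *)

(** Horner's scheme in base 2: the coefficients remain binary numbers, so that the
    polynomials can be computed, and their images unfold to short expressions
    that [ring] and [field] can normalize. *)
Fixpoint ring_of_pos (R : pzRingType) (p : positive) : R :=
  match p with
  | xH => 1
  | xO p => 2 * ring_of_pos R p
  | xI p => 2 * ring_of_pos R p + 1
  end.

Definition ring_of_Z (R : pzRingType) (z : Z) : R :=
  match z with
  | Z0 => 0
  | Zpos p => ring_of_pos R p
  | Zneg p => - ring_of_pos R p
  end.

Lemma ring_of_ZE (R : pzRingType) z : ring_of_Z R z = (int_of_Z z)%:~R.
Proof.
have posE p : ring_of_pos R p = (Pos.to_nat p)%:R.
  elim: p => [p IHp|p IHp|] //=; rewrite IHp.
    by have -> : Pos.to_nat p~1 = (2 * Pos.to_nat p + 1)%N by [lia]; rewrite natrD natrM.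
  by have -> : Pos.to_nat p~0 = (2 * Pos.to_nat p)%N by [lia]; rewrite natrM.
case: z => [|p|p] //=; rewrite posE //.
have : (0 < Pos.to_nat p)%N by lia.
by case: (Pos.to_nat p).
Qed.

Lemma ring_of_Z_opp (R : pzRingType) z : ring_of_Z R (Z.opp z) = - ring_of_Z R z.
Proof. by case: z => [|p|p] /=; rewrite ?oppr0 ?opprK. Qed.

Lemma ring_of_Z_intr (R : pzRingType) z : ring_of_Z R z = (ring_of_Z int z)%:~R.
Proof. by rewrite !ring_of_ZE intz. Qed.

Lemma ring_of_Z_nat (R : pzRingType) n : ring_of_Z R (Z.of_nat n) = n%:R.
Proof. by rewrite ring_of_ZE pmulrn; congr (_%:~R); lia. Qed.

Definition ratQ (q : Q) : rat := ring_of_Z rat (Qnum q) / ring_of_pos rat (Qden q).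

Lemma ring_of_pos_neq0 p : ring_of_pos rat p != 0.
Proof.
rewrite -[ring_of_pos _ _]/(ring_of_Z rat (Zpos p)) ring_of_ZE intr_eq0; lia.
Qed.

Lemma ratQ_Qeq p q : Qeq p q -> ratQ p = ratQ q.
Proof.
rewrite /Qeq /ratQ => pq; apply/eqP; rewrite eqr_div ?ring_of_pos_neq0 //.
rewrite -![ring_of_pos _ _]/(ring_of_Z rat (Zpos _)) !ring_of_ZE -!intrM.
by apply/eqP; congr (_%:~R); rewrite -!(rmorphM int_of_Z); congr int_of_Z.
Qed.

Lemma ratQ_red q : ratQ (Qred q) = ratQ q.
Proof. exact/ratQ_Qeq/Qred_correct. Qed.

Lemma ratQD p q : ratQ (p + q) = ratQ p + ratQ q.
Proof.
rewrite /ratQ addf_div ?ring_of_pos_neq0 //=.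
rewrite -![ring_of_pos _ _]/(ring_of_Z rat (Zpos _)) Pos2Z.inj_mul !ring_of_ZE.
by rewrite -!intrM -intrD -!(rmorphM int_of_Z) -(rmorphD int_of_Z).
Qed.

Lemma ratQM p q : ratQ (p * q) = ratQ p * ratQ q.
Proof.
rewrite /ratQ mulf_div /=.
rewrite -![ring_of_pos _ _]/(ring_of_Z rat (Zpos _)) Pos2Z.inj_mul !ring_of_ZE.
by rewrite -!intrM -!(rmorphM int_of_Z).
Qed.

Lemma ratQ_Z z : ratQ (inject_Z z) = ring_of_Z rat z.
Proof. by rewrite /ratQ /= divr1. Qed.

Lemma ratQ_nat n : ratQ (inject_Z (Z.of_nat n)) = n%:R.
Proof. by rewrite ratQ_Z ring_of_Z_nat. Qed.

(* [ratQ_red] applies only as long as [Qred] is not unfolded. *)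
Local Arguments Qred : simpl never.

Definition monomial := (nat * nat * nat)%type.
(** The terms come in no particular order.  Addition merges terms with the same
    monomial, so the difference of equal polynomials has only zero
    coefficients, which is what [is_zero_poly3] looks for. *)
Definition poly3 := seq (Q * monomial).

Fixpoint add_term (c : Q) (m : monomial) (p : poly3) : poly3 :=
  if p is (c', m') :: p' then
    if m == m' then (Qred (c + c'), m) :: p' else (c', m') :: add_term c m p'
  else [:: (c, m)].

Definition add_poly3 (p q : poly3) : poly3 :=
  foldr (fun t => add_term t.1 t.2) q p.

Definition scale_poly3 (c : Q) (p : poly3) : poly3 :=
  [seq (Qred (c * t.1), t.2) | t <- p].

Definition mul_monomial (m m' : monomial) : monomial :=
  (m.1.1 + m'.1.1, m.1.2 + m'.1.2, m.2 + m'.2)%N.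

Definition mul_term (c : Q) (m : monomial) (p : poly3) : poly3 :=
  [seq (Qred (c * t.1), mul_monomial m t.2) | t <- p].

Definition mul_poly3 (p q : poly3) : poly3 :=
  foldr (fun t => add_poly3 (mul_term t.1 t.2 q)) [::] p.

Definition sub_poly3 (p q : poly3) : poly3 :=
  add_poly3 p (scale_poly3 (inject_Z (-1)) q).

Definition is_zero_poly3 (p : poly3) : bool := all (fun t => Qeq_bool t.1 0) p.

Section Evaluation.

Variables (R : comAlgType rat) (x y z : R).

Definition eval_monomial (m : monomial) : R := x ^+ m.1.1 * y ^+ m.1.2 * z ^+ m.2.

Definition eval (p : poly3) : R := \sum_(t <- p) ratQ t.1 *: eval_monomial t.2.

Lemma eval_nil : eval [::] = 0. Proof. exact: big_nil. Qed.

Lemma eval_cons t p : eval (t :: p) = ratQ t.1 *: eval_monomial t.2 + eval p.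
Proof. exact: big_cons. Qed.

Lemma eval_add_term c m p : eval (add_term c m p) = ratQ c *: eval_monomial m + eval p.
Proof.
elim: p => [|[c' m'] p IHp] /=; first by rewrite eval_cons.
case: eqP => [->|_]; rewrite !eval_cons /=; first by rewrite ratQ_red ratQD scalerDl addrA.
by rewrite IHp addrCA.
Qed.

Lemma eval_add p q : eval (add_poly3 p q) = eval p + eval q.
Proof.
elim: p => [|t p IHp] /=; first by rewrite eval_nil add0r.
by rewrite eval_add_term IHp eval_cons addrA.
Qed.

Lemma eval_scale c p : eval (scale_poly3 c p) = ratQ c *: eval p.
Proof.
rewrite /eval big_map scaler_sumr; apply: eq_bigr => t _ /=.
by rewrite ratQ_red ratQM scalerA.
Qed.

Lemma eval_mul_term c m p : eval (mul_term c m p) = (ratQ c *: eval_monomial m) * eval p.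
Proof.
rewrite /eval big_map mulr_sumr; apply: eq_bigr => t _ /=.
rewrite ratQ_red ratQM -scalerAl -scalerAr scalerA; congr (_ *: _).
by rewrite /eval_monomial !exprD; ring.
Qed.

Lemma eval_mul p q : eval (mul_poly3 p q) = eval p * eval q.
Proof.
elim: p => [|t p IHp] /=; first by rewrite eval_nil mul0r.
by rewrite eval_add eval_mul_term IHp eval_cons mulrDl.
Qed.

Lemma eval_sub p q : eval (sub_poly3 p q) = eval p - eval q.
Proof. by rewrite eval_add eval_scale ratQ_Z scaleN1r. Qed.

Lemma eval_is_zero p : is_zero_poly3 p -> eval p = 0.
Proof.
elim: p => [|t p IHp] /=; first by rewrite eval_nil.
case/andP => /Qeq_bool_eq/ratQ_Qeq t0 /IHp; rewrite eval_cons t0 => ->.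
by rewrite ratQ_Z scale0r addr0.
Qed.

End Evaluation.

(** * The ring generated by S 1, S 3 and S 5 *)

Definition lincomb_poly3 (l : seq (Q * poly3)) : poly3 :=
  foldr (fun t => add_poly3 (scale_poly3 t.1 t.2)) [::] l.

Lemma eval_lincomb (R : comAlgType rat) (x y z : R) l :
  eval x y z (lincomb_poly3 l) = \sum_(t <- l) ratQ t.1 *: eval x y z t.2.
Proof.
elim: l => [|t l IHl] /=; first by rewrite eval_nil big_nil.
by rewrite eval_add eval_scale IHl big_cons.
Qed.

(** [Sk_poly] and [der_Sk_poly] express [S k] and [Der (S k)] by the variables
    [S 1], [S 3] and [S 5]. *)
Definition S1_poly : poly3 := [:: (Qmake 1 1, (1, 0, 0)%N)].
Definition S3_poly : poly3 := [:: (Qmake 1 1, (0, 1, 0)%N)].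
Definition S5_poly : poly3 := [:: (Qmake 1 1, (0, 0, 1)%N)].
Definition S7_poly := lincomb_poly3
  [:: (Qmake 1 1, S3_poly); (Qmake 120 1, mul_poly3 S3_poly S3_poly)].
Definition S9_poly := lincomb_poly3
  [:: (Qmake 21 11, S5_poly); (Qmake (-10) 11, S3_poly);
      (Qmake 5040 11, mul_poly3 S3_poly S5_poly)].
Definition S11_poly := lincomb_poly3
  [:: (Qmake 42 13, S7_poly); (Qmake (-50) 13, S5_poly); (Qmake 21 13, S3_poly);
      (Qmake 10080 13, mul_poly3 S3_poly S7_poly);
      (Qmake 12600 13, mul_poly3 S5_poly S5_poly)].
Definition S13_poly := lincomb_poly3
  [:: (Qmake (-20) 1, S7_poly); (Qmake 21 1, S5_poly); (Qmake 10080 1, mul_poly3 S5_poly S7_poly)].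

Definition der_S1_poly := lincomb_poly3
  [:: (Qmake 5 6, S3_poly); (Qmake 1 6, S1_poly); (Qmake (-2) 1, mul_poly3 S1_poly S1_poly)].
Definition der_S3_poly := lincomb_poly3
  [:: (Qmake 7 10, S5_poly); (Qmake 1 3, S3_poly); (Qmake (-1) 30, S1_poly);
      (Qmake (-8) 1, mul_poly3 S1_poly S3_poly)].
Definition der_S5_poly := lincomb_poly3
  [:: (Qmake 83 140, S7_poly); (Qmake 1 2, S5_poly); (Qmake (-7) 60, S3_poly);
      (Qmake 1 42, S1_poly);
      (Qmake (-12) 1, mul_poly3 S1_poly S5_poly); (Qmake (-14) 1, mul_poly3 S3_poly S3_poly)].

Definition der_term (t : Q * monomial) : poly3 :=
  let: (c, (i, j, k)) := t in
  add_poly3 (mul_term (Qmult c (inject_Z (Z.of_nat i))) (i.-1, j, k) der_S1_poly)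
  (add_poly3 (mul_term (Qmult c (inject_Z (Z.of_nat j))) (i, j.-1, k) der_S3_poly)
     (mul_term (Qmult c (inject_Z (Z.of_nat k))) (i, j, k.-1) der_S5_poly)).

Definition der_poly3 (p : poly3) : poly3 := foldr (fun t => add_poly3 (der_term t)) [::] p.

(** The operator [L (Der)] for the polynomial [L] with coefficient list [l]; on the
    coefficient of [X^n] it is multiplication by [L n] ([coef_diffop]), which is
    how the polynomials in [n] in the five expressions are produced. *)
Fixpoint diffop (l : seq Z) (p : poly3) : poly3 :=
  if l is c :: l' then add_poly3 (scale_poly3 (inject_Z c) p) (der_poly3 (diffop l' p))
  else [::].

Fixpoint table_poly3 (T : seq (seq Z)) (P : nat -> poly3) (k : nat) : poly3 :=
  if T is l :: T' then add_poly3 (diffop l (P k)) (table_poly3 T' P k.+1) else [::].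

Section QuasimodularRing.

Variable N : nat.
Local Notation S := (divisor_series N).
Local Notation ev := (eval (S 1) (S 3) (S 5)).

Lemma S1E : S 1 = ev S1_poly %[upto N].
Proof.
apply: eq_upto_refl; rewrite /eval big_seq1 /eval_monomial /= ratQ_Z scale1r.
by rewrite !expr0 !mulr1 expr1.
Qed.

Lemma S3E : S 3 = ev S3_poly %[upto N].
Proof.
apply: eq_upto_refl; rewrite /eval big_seq1 /eval_monomial /= ratQ_Z scale1r.
by rewrite !expr0 mulr1 mul1r expr1.
Qed.

Lemma S5E : S 5 = ev S5_poly %[upto N].
Proof.
apply: eq_upto_refl; rewrite /eval big_seq1 /eval_monomial /= ratQ_Z scale1r.
by rewrite !expr0 !mul1r expr1.
Qed.

Lemma mulSE i j p q : S i = ev p %[upto N] -> S j = ev q %[upto N] ->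
  S i * S j = ev (mul_poly3 p q) %[upto N].
Proof. by move=> -> ->; rewrite eval_mul. Qed.

Lemma coef_eval_lincomb l i :
  (ev (lincomb_poly3 l))`_i = \sum_(t <- l) ratQ t.1 * (ev t.2)`_i.
Proof. by rewrite eval_lincomb coef_lincomb. Qed.

Lemma S7E : S 7 = ev S7_poly %[upto N].
Proof.
move=> i lti; rewrite divisor_series7 // coef_eval_lincomb !(big_cons, big_nil) /=.
rewrite -(S3E lti) -(mulSE S3E S3E lti) /ratQ.
by cbn [Qnum Qden ring_of_Z ring_of_pos]; field.
Qed.

Lemma S9E : S 9 = ev S9_poly %[upto N].
Proof.
move=> i lti; rewrite divisor_series9 // coef_eval_lincomb !(big_cons, big_nil) /=.
rewrite -(S5E lti) -(S3E lti) -(mulSE S3E S5E lti) /ratQ.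
by cbn [Qnum Qden ring_of_Z ring_of_pos]; field.
Qed.

Lemma S11E : S 11 = ev S11_poly %[upto N].
Proof.
move=> i lti; rewrite divisor_series11 // coef_eval_lincomb !(big_cons, big_nil) /=.
rewrite -(S7E lti) -(S5E lti) -(S3E lti) -(mulSE S3E S7E lti) -(mulSE S5E S5E lti) /ratQ.
by cbn [Qnum Qden ring_of_Z ring_of_pos]; field.
Qed.

Lemma S13E : S 13 = ev S13_poly %[upto N].
Proof.
move=> i lti; rewrite divisor_series13 // coef_eval_lincomb !(big_cons, big_nil) /=.
rewrite -(S7E lti) -(S5E lti) -(mulSE S5E S7E lti) /ratQ.
by cbn [Qnum Qden ring_of_Z ring_of_pos]; field.
Qed.

Lemma Der_S1E : Der (S 1) = ev der_S1_poly %[upto N].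
Proof.
move=> i lti; rewrite Der_divisor_series1 // coef_eval_lincomb !(big_cons, big_nil) /=.
rewrite -(S3E lti) -(S1E lti) -(mulSE S1E S1E lti) /ratQ.
by cbn [Qnum Qden ring_of_Z ring_of_pos]; field.
Qed.

Lemma Der_S3E : Der (S 3) = ev der_S3_poly %[upto N].
Proof.
move=> i lti; rewrite Der_divisor_series3 // coef_eval_lincomb !(big_cons, big_nil) /=.
rewrite -(S5E lti) -(S3E lti) -(S1E lti) -(mulSE S1E S3E lti) /ratQ.
by cbn [Qnum Qden ring_of_Z ring_of_pos]; field.
Qed.

Lemma Der_S5E : Der (S 5) = ev der_S5_poly %[upto N].
Proof.
move=> i lti; rewrite Der_divisor_series5 // coef_eval_lincomb !(big_cons, big_nil) /=.
rewrite -(S7E lti) -(S5E lti) -(S3E lti) -(S1E lti).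
rewrite -(mulSE S1E S5E lti) -(mulSE S3E S3E lti) /ratQ.
by cbn [Qnum Qden ring_of_Z ring_of_pos]; field.
Qed.

Lemma DerX f k : Der (f ^+ k) = k%:R *: (f ^+ k.-1 * Der f).
Proof. by rewrite /Der deriv_exp -scaler_nat -scalerAr; congr (_ *: _); ring. Qed.

(** Leibniz rule, with the differential equations of [S 1], [S 3] and [S 5]. *)
Lemma Der_eval_term t : Der (ratQ t.1 *: eval_monomial (S 1) (S 3) (S 5) t.2)
  = ev (der_term t) %[upto N].
Proof.
case: t => c [[i j] k]; rewrite !eval_add !eval_mul_term !ratQM !ratQ_nat /=.
rewrite -Der_S1E -Der_S3E -Der_S5E /eval_monomial /=.
rewrite DerZ !DerM !DerX; apply: eq_upto_refl.
by rewrite -!mul_polyC !polyCM; ring.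
Qed.

Lemma Der_eval p : Der (ev p) = ev (der_poly3 p) %[upto N].
Proof.
elim: p => [|t p IHp] /=; first by rewrite !eval_nil Der0.
by rewrite eval_cons DerD Der_eval_term IHp eval_add.
Qed.

Fixpoint horner_Z (R : pzRingType) (l : seq Z) (u : R) : R :=
  if l is c :: l' then ring_of_Z R c + u * horner_Z l' u else 0.

Lemma coef_diffop l p i f : (i < N)%N -> f = ev p %[upto N] ->
  (ev (diffop l p))`_i = horner_Z l i%:R * f`_i.
Proof.
move=> lti fp; elim: l => [|c l IHl] /=; first by rewrite eval_nil coef0 mul0r.
rewrite eval_add eval_scale ratQ_Z coefD coefZ -(Der_eval _ lti) coefDer IHl (fp _ lti).
by rewrite mulrDl mulrA.
Qed.

(** Row [j] of the table is the coefficient list of a polynomial in [u], which is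
    multiplied by [F (k + j)]. *)
Fixpoint sum_table (R : pzRingType) (T : seq (seq Z)) (u : R) (F : nat -> R) (k : nat) : R :=
  if T is l :: T' then horner_Z l u * F k + sum_table T' u F k.+1 else 0.

Lemma coef_table T (P : nat -> poly3) (F : nat -> {poly rat}) m k i : (i < N)%N ->
    (forall j, (j < m)%N -> F j = ev (P j) %[upto N]) -> (size T + k <= m)%N ->
  (ev (table_poly3 T P k))`_i = sum_table T i%:R (fun j => (F j)`_i) k.
Proof.
move=> lti FP; elim: T k => [|l T IHT] k /=; first by rewrite eval_nil coef0.
rewrite addSnnS => sizeT; rewrite eval_add coefD IHT // (coef_diffop _ lti (FP k _)) //.
by apply: leq_trans sizeT; rewrite leq_addl.
Qed.

Definition sigma_poly3 (k : nat) : poly3 :=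
  nth [::] [:: S1_poly; S3_poly; S5_poly; S7_poly; S9_poly; S11_poly; S13_poly] k.

Lemma sigma_seriesE k : (k < 7)%N -> S k.*2.+1 = ev (sigma_poly3 k) %[upto N].
Proof.
case: k => [|[|[|[|[|[|[|k]]]]]]] // _; rewrite /sigma_poly3 /=.
- exact: S1E.
- exact: S3E.
- exact: S5E.
- exact: S7E.
- exact: S9E.
- exact: S11E.
- exact: S13E.
Qed.

End QuasimodularRing.

(** * MacMahon's series as polynomials in S 1, S 3 and S 5 *)

(** An odd polynomial in [u] is given by its coefficients at [u], [u^3], ....
    This is the multiplication by [u^2 + e]; [p] is the coefficient carried over
    from the preceding position. *)
Fixpoint mul_square_add (e p : Q) (l : seq Q) : seq Q :=
  if l is c :: l' then Qred (Qplus p (Qmult e c)) :: mul_square_add e c l' else [:: p].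

(** The binomial coefficient ['C(m + j, 2 j + 1)] is an odd polynomial in [m]: it is
    the product of [m] and the [m^2 - i^2] for [0 < i <= j], divided by
    [(2 j + 1)!].  Hence the power sums of the [x_s] involve only the series
    [S k] with odd [k]. *)
Fixpoint bin_odd (j : nat) : seq Q :=
  if j is j'.+1 then
    [seq Qred (Qmult (Qmake 1 (Pos.of_nat (j.*2 * j.*2.+1))) c) |
       c <- mul_square_add (inject_Z (- Z.of_nat (j ^ 2))) (inject_Z 0) (bin_odd j')]
  else [:: inject_Z 1].

Lemma bin_oddS j : bin_odd j.+1 =
  [seq Qred (Qmult (Qmake 1 (Pos.of_nat (j.+1.*2 * j.+1.*2.+1))) c) |
     c <- mul_square_add (inject_Z (- Z.of_nat (j.+1 ^ 2))) (inject_Z 0) (bin_odd j)].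
Proof. by []. Qed.

Fixpoint odd_eval (l : seq Q) (u : rat) (k : nat) : rat :=
  if l is c :: l' then ratQ c * u ^+ k.*2.+1 + odd_eval l' u k.+1 else 0.

Lemma odd_eval_mul_square_add e p l u k :
  odd_eval (mul_square_add e p l) u k =
  ratQ p * u ^+ k.*2.+1 + (u ^+ 2 + ratQ e) * odd_eval l u k.
Proof.
elim: l p k => [|c l IHl] p k /=; first by rewrite mulr0.
rewrite IHl ratQ_red ratQD ratQM doubleS !exprS; ring.
Qed.

Lemma odd_eval_scale c l u k :
  odd_eval [seq Qred (Qmult c c') | c' <- l] u k = ratQ c * odd_eval l u k.
Proof.
elim: l k => [|c' l IHl] k /=; first by rewrite mulr0.
by rewrite IHl ratQ_red ratQM mulrDr mulrA.
Qed.

Lemma ratQ_inv_nat d : (0 < d)%N -> ratQ (Qmake 1 (Pos.of_nat d)) = d%:R^-1.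
Proof.
move=> d_gt0; rewrite /ratQ /= mul1r; congr (_^-1).
rewrite -[ring_of_pos _ _]/(ring_of_Z rat (Zpos _)) -ring_of_Z_nat; congr (ring_of_Z _ _).
lia.
Qed.

Lemma bin_odd_step (m j : nat) :
  (j.+1.*2 * j.+1.*2.+1)%:R * 'C(m + j.+1, j.+1.*2.+1)%:R =
  (m%:R ^+ 2 - (j.+1 ^ 2)%:R) * 'C(m + j, j.*2.+1)%:R :> rat.
Proof.
have [lemj|ltjm] := leqP m j.
  by rewrite !bin_small ?mulr0 //; lia.
have -> : (m%:R ^+ 2 - (j.+1 ^ 2)%:R : rat) = ((m + j.+1) * (m - j.+1))%:R.
  by rewrite natrM natrD natrB // natrX; ring.
rewrite -!natrM; congr _%:R.
have E1 := mul_bin_left (m + j) j.*2.+1; have E2 := mul_bin_diag (m + j).+1 j.*2.+2.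
rewrite (_ : m - j.+1 = m + j - j.*2.+1)%N; last by lia.
by rewrite doubleS addnS -mulnA -E2 mulnCA E1 mulnA.
Qed.

Lemma bin_oddE m j : 'C(m + j, j.*2.+1)%:R = odd_eval (bin_odd j) m%:R 0.
Proof.
elim: j => [|j IHj]; first by rewrite /= addn0 bin1 ratQ_Z mul1r expr1 addr0.
rewrite bin_oddS odd_eval_scale odd_eval_mul_square_add ratQ_inv_nat // -IHj !ratQ_Z.
rewrite ring_of_Z_opp ring_of_Z_nat mul0r add0r -bin_odd_step.
by rewrite mulKf // pnatr_eq0.
Qed.

Lemma size_bin_odd j : size (bin_odd j) = j.+1.
Proof.
have size_msa e p l : size (mul_square_add e p l) = (size l).+1.
  by elim: l p => //= c l IHl p; rewrite IHl.
by elim: j => //= j IHj; rewrite size_map size_msa IHj.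
Qed.

Fixpoint sigma_comb (l : seq Q) (k : nat) : poly3 :=
  if l is c :: l' then add_poly3 (scale_poly3 c (sigma_poly3 k)) (sigma_comb l' k.+1)
  else [::].

Definition power_sum_poly3 (j : nat) : poly3 := sigma_comb (bin_odd j) 0.

Fixpoint newton_sum (As : seq poly3) (j : nat) : poly3 :=
  if As is A :: As' then
    add_poly3 (scale_poly3 (inject_Z (if odd j then -1 else 1)) (mul_poly3 (power_sum_poly3 j) A))
      (newton_sum As' j.+1)
  else [::].

(** The polynomials of [A_k], ..., [A_0]: in this decreasing order, Newton's
    identity pairs the entry at position [j] with the power sum of index [j + 1]. *)
Fixpoint macmahon_polys (k : nat) : seq poly3 :=
  if k is k'.+1 then
    scale_poly3 (Qmake 1 (Pos.of_nat k)) (newton_sum (macmahon_polys k') 0)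
      :: macmahon_polys k'
  else [:: [:: (inject_Z 1, (0, 0, 0)%N)]].

Lemma size_macmahon_polys k : size (macmahon_polys k) = k.+1.
Proof. by elim: k => //= k ->. Qed.

Section MacMahonQuasimodular.

Variable N : nat.
Local Notation ev := (eval (divisor_series N 1) (divisor_series N 3) (divisor_series N 5)).

Lemma lambert_odd_eval l k : (k + size l <= 7)%N ->
  lambert N (fun m => odd_eval l m%:R k) = ev (sigma_comb l k) %[upto N].
Proof.
elim: l k => [|c l IHl] k /= sizel.
  by apply: eq_upto_refl; rewrite eval_nil /lambert big1 // => m _; rewrite scale0r.
rewrite lambertD lambertZ -/(divisor_series N _) sigma_seriesE ?IHl ?eval_add ?eval_scale //.
all: lia.
Qed.

Lemma power_sumE j : (j < 7)%N ->
  \sum_i mpart_pos (N := N) i ^+ j.+1 = ev (power_sum_poly3 j) %[upto N].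
Proof.
move=> ltj7; rewrite power_sum_mpart -lambert_odd_eval ?size_bin_odd //.
by apply: eq_upto_refl; apply: eq_lambert => m _; apply: bin_oddE.
Qed.

Lemma eval_newton_sum As j :
  ev (newton_sum As j) =
  \sum_(i < size As) (-1) ^+ (j + i) * ev (power_sum_poly3 (j + i)) * ev (nth [::] As i).
Proof.
elim: As j => [|A As IHAs] j /=; first by rewrite big_ord0 eval_nil.
rewrite eval_add eval_scale eval_mul IHAs big_ord_recl /= addn0; congr (_ + _).
  rewrite ratQ_Z -signr_odd -mulrA; case: odd; first by rewrite scaleN1r mulN1r.
  by rewrite scale1r mul1r.
by apply: eq_bigr => i _; rewrite /bump /= add1n addSnnS.
Qed.

Lemma macmahon_polysE k j : (j <= k <= 7)%N ->
  macmahon_series N (k - j) = ev (nth [::] (macmahon_polys k) j) %[upto N].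
Proof.
elim: k j => [|k IHk] [|j] // /andP[lejk ltk7].
- apply: eq_upto_refl; rewrite /macmahon_series esym0.
  by rewrite /eval big_seq1 /eval_monomial /= ratQ_Z scale1r !mulr1.
- rewrite subn0 -[nth _ _ _]/(scale_poly3 (Qmake 1 (Pos.of_nat k.+1))
                                 (newton_sum (macmahon_polys k) 0)).
  rewrite eval_scale eval_newton_sum ratQ_inv_nat // size_macmahon_polys.
  transitivity (k.+1%:R^-1 *: (k.+1%:R * macmahon_series N k.+1)).
    by apply: eq_upto_refl; rewrite mulr_natl -scaler_nat scalerA mulVf ?scale1r ?pnatr_eq0.
  apply: eq_upto_scale; rewrite newton_identity; apply: eq_upto_sum => -[i lti] _ /=.
  rewrite power_sumE -?IHk //; last by lia.
  by rewrite -ltnS lti ltnW.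
by rewrite subSS; apply: IHk; lia.
Qed.

End MacMahonQuasimodular.

(** * Identities between MacMahon's functions and divisor sums *)

Lemma sum_divisors (V : nmodType) n (F : nat -> V) :
  \sum_(d <- divisors n.+1) F d = \sum_(1 <= d < n.+2 | (d %| n.+1)%N) F d.
Proof.
rewrite -[RHS]big_filter; apply: perm_big; apply: uniq_perm.
- exact: divisors_uniq.
- by rewrite filter_uniq ?iota_uniq.
move=> d; rewrite -dvdn_divisors // mem_filter mem_index_iota andbC.
case: (boolP (d %| n.+1)%N) => [dvd_d|]; last by rewrite andbF.
by rewrite (dvdn_gt0 _ dvd_d) // ltnS dvdn_leq.
Qed.

Lemma coef_lambert n c :
  (lambert n.+2 c)`_n.+1 = \sum_(d <- divisors n.+1) c d.
Proof.
rewrite sum_divisors coef_lincomb [RHS]big_mkcond; apply: eq_big_nat => d /andP[d_gt0 _].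
rewrite coef_sum; under eq_bigr do rewrite coefXn.
case: ifP => [/dvdnP[k nE]|/negP ndvd]; last first.
  rewrite big1 ?mulr0 // => x _; case: eqP => // nE.
  by case: ndvd; rewrite nE dvdn_mulr.
have k_gt0 : (0 < k)%N by move: nE; case: k.
rewrite (bigD1_seq k) ?iota_uniq //=; last first.
  by rewrite mem_index_iota k_gt0 nE ltnS leq_pmulr.
rewrite nE mulnC eqxx big1 ?addr0 ?mulr1 // => x /negPf neqx.
by rewrite eqn_pmul2l // eq_sym neqx.
Qed.

(** The polynomial of [A_(a+1)], for [a < 7]; the list starts with [A_7]. *)
Definition macmahon_poly3 (a : nat) : poly3 := nth [::] (macmahon_polys 7) (6 - a).

Definition table_check (c : Z) (TM TS : seq (seq Z)) : bool :=
  is_zero_poly3 (sub_poly3 (scale_poly3 (inject_Z c) (table_poly3 TM macmahon_poly3 0))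
                           (table_poly3 TS sigma_poly3 0)).

Lemma horner_Z_intr l (u : int) : horner_Z l u%:~R = (horner_Z l u)%:~R :> rat.
Proof.
by elim: l => //= c l IHl; rewrite IHl intrD intrM -ring_of_Z_intr.
Qed.

Lemma sum_table_intr T (u : int) F k :
  sum_table T u%:~R (fun j => (F j)%:~R) k = (sum_table T u F k)%:~R :> rat.
Proof.
by elim: T k => //= l T IHT k; rewrite IHT intrD intrM horner_Z_intr.
Qed.

Lemma eq_sum_table (R : pzRingType) T (u : R) F G k :
  (forall j, F j = G j) -> sum_table T u F k = sum_table T u G k.
Proof. by move=> FG; elim: T k => //= l T IHT k; rewrite IHT FG. Qed.

(** Equal polynomials in [S 1], [S 3] and [S 5] give equal series, and the claim
    compares the coefficients of [X^n]. *)
Lemma table_identity c TM TS n : (size TM <= 7)%N -> (size TS <= 7)%N ->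
    table_check c TM TS -> (0 < n)%N ->
  ring_of_Z int c * sum_table TM n%:Z (fun a => (macmahon a.+1 n)%:Z) 0 =
  sum_table TS n%:Z (fun k => \sum_(d <- divisors n) (d%:Z) ^+ k.*2.+1) 0.
Proof.
case: n => // n sizeM sizeS check _.
pose N := n.+2; have ltnN : (n.+1 < N)%N by [].
have := eval_is_zero (divisor_series N 1) (divisor_series N 3) (divisor_series N 5) check.
rewrite eval_sub eval_scale ratQ_Z => /eqP; rewrite subr_eq0 => /eqP eqT.
move: (congr1 (fun f : {poly rat} => f`_n.+1) eqT).
rewrite coefZ (coef_table (F := fun a => macmahon_series N a.+1) (m := 7)) ?addn0 //; last first.
  move=> a lta7; rewrite /macmahon_poly3 -macmahon_polysE; last by lia.
  by rewrite (_ : 7 - (6 - a) = a.+1)%N //; lia.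
rewrite (coef_table (F := fun k => divisor_series N k.*2.+1) (m := 7)) ?addn0 //; last first.
  by move=> k ltk7; apply: sigma_seriesE.
move=> E; apply/(intr_inj (R := rat)).
rewrite intrM -ring_of_Z_intr -!sum_table_intr -!pmulrn.
rewrite (eq_sum_table _ _ (G := fun a => (macmahon_series N a.+1)`_n.+1)); last first.
  by move=> a; rewrite -macmahonE pmulrn.
rewrite E; apply: eq_sum_table => k.
rewrite coef_lambert rmorph_sum; apply: eq_bigr => d _.
by rewrite rmorphXn.
Qed.

Section Tables.

Local Open Scope Z_scope.

(** Row [a] of [macmahon_table] lists, by increasing degree, the coefficients of the
    polynomial in [n] that multiplies [macmahon a.+1 n]; row [k] of [sigma_table]
    does so for the sum of the [(2 k + 1)]-th powers of the divisors of [n]. *)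
Definition macmahon_table1 : seq (seq Z) :=
  [:: [:: 2; -3; 1];
      [:: -8]].
Definition macmahon_table2 : seq (seq Z) :=
  [:: [:: -8; 18; -13; 3];
      [:: 212; -120; 12];
      [:: -960]].
Definition macmahon_table3 : seq (seq Z) :=
  [:: [:: 170; -447; 423; -171; 25];
      [:: -14990; 12900; -3554; 300];
      [:: 214080; -60480; 2400];
      [:: -725760]].
Definition macmahon_table4 : seq (seq Z) :=
  [:: [:: -2670; 8097; -9323; 5073; -1303; 126];
      [:: 695490; -737100; 288014; -48900; 3024];
      [:: -23496480; 10644480; -1510080; 60480];
      [:: 218453760; -36288000; 725760];
      [:: -580608000]].
Definition macmahon_table5 : seq (seq Z) :=
  [:: [:: -746500; 2903750; -4575760; 3726801; -1651959; 377959; -33049; -1542; 300];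
      [:: 1585493500; -2210467000; 1239098170; -351366300; 50637162; -2799900; -91008; 12000];
      [:: -236150560800; 161101416000; -42370071840; 5133219840; -236343840; -3548160; 432000];
      [:: 8555162112000; -3123876672000; 396192142080; -17599680000; -72817920; 12096000];
      [:: -112944125952000; 21310248960000; -1056513024000; 0; 193536000];
      [:: 604436152320000; -46495088640000];
      [:: -1115882127360000]].

Definition sigma_table1 : seq (seq Z) := [:: [:: 1; -1; 1]; [:: -1]].

Definition sigma_table2 : seq (seq Z) := [:: [:: 0; 0; -3]; [:: 3; 0; 3]; [:: -3]].

Definition sigma_table3 : seq (seq Z) := [:: [::]; [:: 0; 0; -15]; [:: 15; 0; 15]; [:: -15]].

Definition sigma_table4 : seq (seq Z) := [:: [::]; [::]; [:: 0; 0; -15]; [:: 15; 0; 15]; [:: -15]].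

Definition sigma_table5 : seq (seq Z) := 
  [:: [::]; [::]; [::]; [:: 0; 0; -5; 0; -5]; [:: 5; 0; 5; 0; 5]; [::]; [:: -5]].

End Tables.

(** For a divisor [d] of [n], neither [d^2 - 1] nor [n^2 - d^2] is negative, and
    their product vanishes only for [d = 1] and [d = n]. *)
Lemma divisor_sum_detects_primes (n : nat) (c e : int) (w : nat -> int) :
    (0 < n)%N -> 0 < c -> (forall d, (d %| n)%N -> 0 < w d) ->
    c * e = \sum_(d <- divisors n) w d * ((d%:Z ^+ 2 - 1) * (n%:Z ^+ 2 - d%:Z ^+ 2)) ->
  0 <= e /\ ((2 <= n)%N -> (e = 0 <-> prime n)).
Proof.
move=> n_gt0 c_gt0 w_gt0 eE.
have factors_ge0 d : (d %| n)%N -> (0 <= d%:Z ^+ 2 - 1) && (0 <= n%:Z ^+ 2 - d%:Z ^+ 2).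
  move=> dvd_d; have d_gt0 := dvdn_gt0 n_gt0 dvd_d; have := dvdn_leq n_gt0 dvd_d.
  by nia.
pose F d := w d * ((d%:Z ^+ 2 - 1) * (n%:Z ^+ 2 - d%:Z ^+ 2)).
have F_ge0 d : (d %| n)%N -> 0 <= F d.
  move=> dvd_d; have /andP[? ?] := factors_ge0 d dvd_d.
  by rewrite mulr_ge0 ?mulr_ge0 // ltW // w_gt0.
have eq0E : (e == 0) = all (fun d => F d == 0) (divisors n).
  rewrite -(mulrI_eq0 e (lregP (lt0r_neq0 c_gt0))) eE big_seq psumr_eq0; last first.
    by move=> d; rewrite -dvdn_divisors // => /F_ge0.
  by apply: eq_in_all => d ->.
split.
  rewrite -(pmulr_rge0 _ c_gt0) eE big_seq sumr_ge0 // => d.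
  by rewrite -dvdn_divisors // => /F_ge0.
move=> n_ge2; have F0 d : (d %| n)%N -> (F d == 0) = (d == 1)%N || (d == n).
  move=> dvd_d; rewrite !mulf_eq0 gt_eqF ?w_gt0 //=.
  by apply/idP/idP; move: dvd_d => /(dvdn_leq n_gt0); nia.
split=> [/eqP|pr_n]; first rewrite eq0E.
  move=> /allP allF; apply/primeP; split=> // d dvd_d.
  by rewrite -F0 //; apply: allF; rewrite -dvdn_divisors.
apply/eqP; rewrite eq0E; apply/allP => d; rewrite -dvdn_divisors // => dvd_d.
by rewrite F0 //; case/primeP: pr_n => _; apply.
Qed.

Lemma sum_divisors_codivisor (n : nat) : (0 < n)%N ->
  \sum_(d <- divisors n) (n %/ d)%:Z = \sum_(d <- divisors n) d%:Z.
Proof.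
move=> n_gt0.
have codivK d : (d %| n)%N -> (n %/ (n %/ d))%N = d.
  move=> /dvdnP[q nE]; move: n_gt0; rewrite nE muln_gt0 => /andP[q_gt0 d_gt0].
  by rewrite mulnK // mulKn.
rewrite -(big_map (fun d => n %/ d)%N xpredT (fun d => d%:Z)).
apply: perm_big; apply: uniq_perm; rewrite ?divisors_uniq //.
  rewrite map_inj_in_uniq ?divisors_uniq // => d d'.
  by rewrite -!dvdn_divisors // => dn d'n eqd; rewrite -(codivK d) // eqd codivK.
move=> d; rewrite -dvdn_divisors //; apply/mapP/idP => [[d' + ->]|dvd_d].
  by rewrite -dvdn_divisors // => ?; rewrite dvdn_div.
by exists (n %/ d)%N; rewrite ?codivK // -dvdn_divisors // dvdn_div.
Qed.

Lemma table_check1 : table_check 1 macmahon_table1 sigma_table1.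
Proof. by vm_compute. Qed.

Lemma table_check2 : table_check 2 macmahon_table2 sigma_table2.
Proof. by vm_compute. Qed.

Lemma table_check3 : table_check 4 macmahon_table3 sigma_table3.
Proof. by vm_compute. Qed.

Lemma table_check4 : table_check 4 macmahon_table4 sigma_table4.
Proof. by vm_compute. Qed.

Lemma table_check5 : table_check 4 macmahon_table5 sigma_table5.
Proof. by vm_compute. Qed.

(** * Prime detection *)

Lemma E1_table n : E1 n = sum_table macmahon_table1 n%:Z (fun a => (macmahon a.+1 n)%:Z) 0.
Proof.
rewrite /E1; cbn [macmahon_table1 sum_table horner_Z ring_of_Z ring_of_pos]; ring.
Qed.

Lemma E2_table n : E2 n = sum_table macmahon_table2 n%:Z (fun a => (macmahon a.+1 n)%:Z) 0.
Proof.
rewrite /E2; cbn [macmahon_table2 sum_table horner_Z ring_of_Z ring_of_pos]; ring.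
Qed.

Lemma E3_table n : E3 n = sum_table macmahon_table3 n%:Z (fun a => (macmahon a.+1 n)%:Z) 0.
Proof.
rewrite /E3; cbn [macmahon_table3 sum_table horner_Z ring_of_Z ring_of_pos]; ring.
Qed.

Lemma E4_table n : E4 n = sum_table macmahon_table4 n%:Z (fun a => (macmahon a.+1 n)%:Z) 0.
Proof.
rewrite /E4; cbn [macmahon_table4 sum_table horner_Z ring_of_Z ring_of_pos]; ring.
Qed.

Lemma E5_table n : E5 n = sum_table macmahon_table5 n%:Z (fun a => (macmahon a.+1 n)%:Z) 0.
Proof.
rewrite /E5; cbn [macmahon_table5 sum_table horner_Z ring_of_Z ring_of_pos]; ring.
Qed.

Lemma sum_table_sum (R : pzRingType) (I : Type) (r : seq I) T (u : R) F k :
  sum_table T u (fun j => \sum_(i <- r) F j i) k =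
  \sum_(i <- r) sum_table T u (fun j => F j i) k.
Proof.
elim: T k => [|l T IHT] k /=; first by rewrite big1.
by rewrite IHT mulr_sumr -big_split.
Qed.

Lemma table_detects_primes c TM TS (E : nat -> int) (w : nat -> nat -> int) n :
    (size TM <= 7)%N -> (size TS <= 7)%N -> table_check (Zpos c) TM TS ->
    E n = sum_table TM n%:Z (fun a => (macmahon a.+1 n)%:Z) 0 ->
    (forall d, sum_table TS n%:Z (fun k => d%:Z ^+ k.*2.+1) 0 =
      w n d * ((d%:Z ^+ 2 - 1) * (n%:Z ^+ 2 - d%:Z ^+ 2))) ->
    (forall d, (d %| n)%N -> 0 < w n d) -> (0 < n)%N ->
  0 <= E n /\ ((2 <= n)%N -> (E n = 0 <-> prime n)).
Proof.
move=> sizeM sizeS check EM wE w_gt0 n_gt0.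
apply: (divisor_sum_detects_primes (c := ring_of_Z int (Zpos c)) n_gt0 _ w_gt0).
  by rewrite ring_of_ZE intz; lia.
rewrite EM (table_identity sizeM sizeS check n_gt0) sum_table_sum.
by apply: eq_bigr.
Qed.

(** The table identity gives [E1 n] as the sum of [(n^2 - n + 1) d - d^3], which is
    negative for [d = n].  The sum does not change if a multiple of [d] is
    replaced by the same multiple of the complementary divisor [n / d], and a
    suitable multiple makes the term vanish for [d = 1] and [d = n]. *)
Lemma E1_divisor_sum n : (0 < n)%N ->
  n%:Z * E1 n = \sum_(d <- divisors n)
    (n %/ d)%:Z * ((d%:Z ^+ 2 - 1) * (n%:Z ^+ 2 - d%:Z ^+ 2)).
Proof.
move=> n_gt0; have := @table_identity _ macmahon_table1 sigma_table1 n isT isT table_check1 n_gt0.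
rewrite -E1_table sum_table_sum mul1r => ->.
transitivity (\sum_(d <- divisors n) (n%:Z * (n%:Z ^+ 2 * d%:Z - d%:Z ^+ 3)
    + n%:Z * d%:Z - n%:Z ^+ 2 * d%:Z)).
  rewrite mulr_sumr; apply: eq_bigr => d _.
  by cbn [sigma_table1 sum_table horner_Z ring_of_Z ring_of_pos double]; ring.
rewrite sumrB -[in X in _ - X]mulr_sumr -sum_divisors_codivisor // mulr_sumr -sumrB.
rewrite big_seq [RHS]big_seq; apply: eq_bigr => d; rewrite -dvdn_divisors // => dvd_d.
rewrite -[in LHS](divnK dvd_d) -[n in (n%:Z ^+ 2 - _)](divnK dvd_d).
by rewrite mulnK ?(dvdn_gt0 n_gt0) // !PoszM; ring.
Qed.

Theorem theorem1p2 (E : nat -> int)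
    (hE : E = E1 \/ E = E2 \/ E = E3 \/ E = E4 \/ E = E5) :
  (forall n : nat, (0 < n)%N -> 0 <= E n) /\
  (forall n : nat, (2 <= n)%N -> (E n = 0 <-> prime n)).
Proof.
suff detect n : (0 < n)%N -> 0 <= E n /\ ((2 <= n)%N -> (E n = 0 <-> prime n)).
  by split=> n n_gt0; case: (detect n) => // [|_]; [exact: ltnW | apply].
move=> n_gt0; have dvd_gt0 d : (d %| n)%N -> (0 < d)%N by exact: dvdn_gt0.
case: hE => [-> | [-> | [-> | [-> | ->]]]].
- apply: (divisor_sum_detects_primes (c := n%:Z) n_gt0 _ _ (E1_divisor_sum n_gt0)) => // d dvd_d.
  by rewrite ltz_nat divn_gt0 ?dvd_gt0 // dvdn_leq.
- apply: (table_detects_primes (w := fun n d => 3 * d%:Z) _ _ table_check2 (E2_table n)) => // d.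
    by cbn [sigma_table2 sum_table horner_Z ring_of_Z ring_of_pos double]; ring.
  by move/dvd_gt0; nia.
- apply: (table_detects_primes (w := fun n d => 15 * d%:Z ^+ 3)
            _ _ table_check3 (E3_table n)) => // d.
    by cbn [sigma_table3 sum_table horner_Z ring_of_Z ring_of_pos double]; ring.
  by move/dvd_gt0 => d_gt0; rewrite pmulr_rgt0 // exprn_gt0.
- apply: (table_detects_primes (w := fun n d => 15 * d%:Z ^+ 5)
            _ _ table_check4 (E4_table n)) => // d.
    by cbn [sigma_table4 sum_table horner_Z ring_of_Z ring_of_pos double]; ring.
  by move/dvd_gt0 => d_gt0; rewrite pmulr_rgt0 // exprn_gt0.
- apply: (table_detects_primes (w := fun n d => 5 * d%:Z ^+ 7 * (1 + n%:Z ^+ 2 + d%:Z ^+ 2))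
            _ _ table_check5 (E5_table n)) => // d.
    by cbn [sigma_table5 sum_table horner_Z ring_of_Z ring_of_pos double]; ring.
  by move/dvd_gt0 => d_gt0; rewrite !pmulr_rgt0 ?exprn_gt0.
Qed.
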